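(* Let $\xi \sim N(0,1)$ and suppose that $$\lim_{n \rightarrow \infty} \frac{1}{s_n^2} \max_{1 \leq k \leq n} \sigma_k^2 = 0.$$ Then $\frac{n}{s_n}\left(\overline{X}_n - \mu\right)$ converges weakly (in distribution) to $\xi$ as $n \to \infty$.
   Context: Let $F$ be a cumulative distribution function on $\mathbb{R}$ with $\int_{-\infty}^\infty x\, dF(x) = 0$ and $\int_{-\infty}^\infty x^2\, dF(x) = 1$. Fix $\mu \in \mathbb{R}$, and for each integer $k \geq 1$ let $p_k \in [0,1]$ and $\sigma_k \in [1,\infty)$. Let $X_1, X_2, \ldots$ be independent random variables such that, for each $k$, $X_k$ has cumulative distribution function $x \mapsto (1-p_k) F(x-\mu) + p_k F\left(\frac{x-\mu}{\sigma_k}\right)$. Put $\overline{X}_n = \frac{1}{n} \sum_{k=1}^n X_k$ and $s_n^2 = \sum_{k=1}^n [(1-p_k) + p_k \sigma_k^2]$, with $s_n > 0$. *)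

(* Defs.v *)
From HB Require Import structures.
From mathcomp Require Import all_boot all_order all_algebra finmap.
From mathcomp Require Import all_classical all_reals all_analysis.
(* not re-exported by all_analysis; provides the ring structure of
   {mfun T >-> R} *)
From mathcomp Require Import measurable_realfun.

Set Implicit Arguments.
Unset Strict Implicit.
Unset Printing Implicit Defensive.

Import Order.TTheory GRing.Theory Num.Theory.
Import numFieldNormedType.Exports.

Local Open Scope classical_set_scope.
Local Open Scope ring_scope.

Definition mutually_independent d (T : measurableType d) (R : realType)
    (P : probability T R) (I : choiceType) (X : I -> {RV P >-> R}) : Prop :=
  forall (J : {fset I}) (B : I -> set R),
    (forall i, i \in J -> measurable (B i)) ->
    P (\bigcap_(i in [set` J]) X i @^-1` B i) =
    (\prod_(i <- J) P (X i @^-1` B i))%E.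

(* The equality is only required on Borel sets: the underlying set functions
   are total and carry no meaning on other sets. *)
Definition has_law d (T : measurableType d) (R : realType)
    (P : probability T R) (X : {RV P >-> R}) (nu : set R -> \bar R) : Prop :=
  forall A : set R, measurable A -> distribution P X A = nu A.

Definition converges_weakly d (T : measurableType d) d' (T' : measurableType d')
    (R : realType) (P : probability T R) (P' : probability T' R)
    (Y : nat -> {RV P >-> R}) (Z : {RV P' >-> R}) : Prop :=
  forall f : R -> R, continuous f -> bounded_fun f ->
    ('E_P[f \o Y n] @[n --> \oo] --> 'E_P'[f \o Z])%E.

(* Sequences are indexed from 0: index k stands for k + 1 in the usual
   numbering, so that k < n enumerates the first n terms. *)

Definition sample_mean d (T : measurableType d) (R : realType)
    (P : probability T R) (X : nat -> {RV P >-> R}) (n : nat) : {RV P >-> R} :=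
  n%:R^-1 \o* (\sum_(k < n) (X k : {mfun T >-> R})).

Definition total_sd (R : realType) (p sigma : nat -> R) (n : nat) : R :=
  Num.sqrt (\sum_(k < n) ((1 - p k) + p k * sigma k ^+ 2)).

Definition standardized_mean d (T : measurableType d) (R : realType)
    (P : probability T R) (X : nat -> {RV P >-> R}) (mu : R)
    (p sigma : nat -> R) (n : nat) : {RV P >-> R} :=
  (n%:R / total_sd p sigma n) \o*
    ((sample_mean X n : {mfun T >-> R}) \- cst mu).

(* Main.v *)
From HB Require Import structures.
Require Import Defs.
From mathcomp Require Import all_boot all_order all_algebra finmap.
From mathcomp Require Import all_classical all_reals all_analysis.
From mathcomp Require Import measurable_realfun ring lra.

Import Order.TTheory GRing.Theory Num.Theory.
Import numFieldNormedType.Exports.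

Set Implicit Arguments.
Unset Strict Implicit.
Unset Printing Implicit Defensive.

Local Open Scope classical_set_scope.
Local Open Scope ring_scope.

(** This is Lindeberg's replacement argument, carried out on laws: the normal
    variables that replace the summands are integrated out on their own space
    instead of being added to the space of the X_k.

    Call g a test function when it has two bounded coefficient functions g1, g2
    with g (x + h) = g x + h g1 x + h^2/2 g2 x up to a multiple of |h|^3.  If Y
    is centred with variance v, then averaging over Y turns g into
    g + (v/2) g2, up to a multiple of E[Y^2 min(1, |Y|)]; only the variance of
    Y enters the main term, so Y may be traded for a centred normal variable of
    variance v at the price of two such remainders ([lindeberg_step]).  Test
    functions are stable under averaging ([taylor_bounded_average]), hence the
    terms of an independent sum can be traded one after the other, and the
    normal laws met on the way merge into a single one
    ([normal_convolution]).  This yields [lindeberg_replacement].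

    In the mixture model X_k - mu is distributed as U or as sigma_k U, where U
    has distribution function F.  After division by s_n both scales are at most
    a_n = max_(k < n) sigma_k / s_n, so the remainder of the k-th term is at
    most its share of the total variance times E[U^2 min(1, a_n |U|)], and
    likewise for its normal substitute, with a standard normal U.  The shares
    add up to 1, and both expectations tend to 0 with a_n by dominated
    convergence ([lindeberg_bound], [cvg_tail_moment]).

    It remains to pass from test functions to bounded continuous functions
    ([converges_weakly_test]).  A cubic spline rising from 0 to 1 is a test
    function; combinations of its rescalings approximate a continuous function
    uniformly on an interval, and two of them form a bump that dominates the
    complement of a large interval.  As the normal law charges that complement
    very little, so do, in the limit, the laws of the standardized means. *)

(** * Functions with a second-order Taylor expansion *)

Section test_functions.
Context {R : realType}.
Implicit Types (g : R -> R) (C x y h a b : R).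

(** The coefficients [g1] and [g2] play the role of the first two derivatives
    of [g], but only the expansion is asked of them: it passes to averages of
    [g] by mere integration, whereas differentiability would require
    differentiating under the integral sign. *)
Definition taylor_bounded C g g1 g2 := [/\
  measurable_fun setT g1, measurable_fun setT g2,
  forall x, [/\ `|g x| <= C, `|g1 x| <= C & `|g2 x| <= C] &
  forall x h,
    `|g (x + h) - (g x + h * g1 x + h ^+ 2 / 2 * g2 x)| <= C * `|h| ^+ 3].

Definition test_function g := exists C g1 g2, taylor_bounded C g g1 g2.

Lemma taylor_bounded_ge0 C g g1 g2 : taylor_bounded C g g1 g2 -> 0 <= C.
Proof. by case=> _ _ /(_ 0)[g0 _ _] _; exact: le_trans g0. Qed.

Lemma taylor_bounded_continuous C g g1 g2 :
  taylor_bounded C g g1 g2 -> continuous g.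
Proof.
move=> tg; have C0 := taylor_bounded_ge0 tg; case: tg => _ _ gC gT x.
apply/cvgrPdist_le => /= e e0.
near=> y.
have h1 : `|y - x| <= 1.
  by near: y; exists 1 => //= y /=; rewrite distrC => /ltW.
(* for |h| <= 1 the linear and quadratic terms and the remainder are
   each at most C |h| *)
have h2 : `|y - x| * (C *+ 3 + 1) <= e.
  rewrite -ler_pdivlMr; last by apply: ltr_wpDl => //; exact: mulrn_wge0.
  near: y; exists (e / (C *+ 3 + 1)) => /=.
    by rewrite divr_gt0// ltr_wpDl// mulrn_wge0.
  by move=> y /=; rewrite distrC => /ltW.
have := gT x (y - x); rewrite (addrC x) subrK => gT1.
have [_ g1C g2C] := gC x.
set h := y - x in h1 h2 gT1.
have hh : `|h| ^+ 2 <= `|h| by rewrite expr2 ler_piMl.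
have hhh : `|h| ^+ 3 <= `|h|.
  by rewrite exprS (le_trans _ hh)// expr2 ler_wpM2l// expr2 ler_piMl.
have -> : g x - g y = - ((g y - (g x + h * g1 x + h ^+ 2 / 2 * g2 x)) +
  (h * g1 x + h ^+ 2 / 2 * g2 x)) by lra.
rewrite normrN; apply: le_trans h2; apply: (le_trans (ler_normD _ _)).
have : `|h * g1 x + h ^+ 2 / 2 * g2 x| <= `|h| * C + `|h| * C.
  apply: (le_trans (ler_normD _ _)); apply: lerD; rewrite !normrM.
    by rewrite ler_wpM2l.
  apply: ler_pM => //.
  by rewrite (ger0_norm (x := 2^-1))//; nra.
move: (ler_wpM2l C0 hhh); have := normr_ge0 h; nra.
Unshelve. all: by end_near. Qed.

Lemma taylor_bounded_measurable C g g1 g2 :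
  taylor_bounded C g g1 g2 -> measurable_fun setT g.
Proof. by move/taylor_bounded_continuous; exact: continuous_measurable_fun. Qed.

Lemma test_function_affine a b g : test_function g ->
  test_function (fun x => g (a * x + b)).
Proof.
move=> [C [g1 [g2 tg]]]; have C0 := taylor_bounded_ge0 tg.
case: tg => mg1 mg2 gC gT.
have ma : measurable_fun [set: R] (fun x => a * x + b).
  by apply: measurable_funD => //; exact: measurable_funM.
(* (1 + |a|)^3 dominates 1, |a|, |a|^2 and |a|^3 *)
exists (C * (1 + `|a|) ^+ 3), (fun x => a * g1 (a * x + b)),
  (fun x => a ^+ 2 * g2 (a * x + b)); split.
- by apply: measurable_funM => //; exact: measurableT_comp.
- by apply: measurable_funM => //; exact: measurableT_comp.
- move=> x; have [gx g1x g2x] := gC (a * x + b).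
  have a0 := normr_ge0 a.
  split; rewrite ?normrM ?normrX.
  + by apply: (le_trans gx); rewrite ler_peMr// exprn_ege1// lerDl.
  + rewrite mulrC; apply: ler_pM => //; nra.
  + rewrite mulrC; apply: ler_pM => //; nra.
- move=> x h; have := gT (a * x + b) (a * h).
  rewrite mulrDr addrAC => le.
  have -> : h * (a * g1 (a * x + b)) = a * h * g1 (a * x + b) by ring.
  have -> : h ^+ 2 / 2 * (a ^+ 2 * g2 (a * x + b)) =
    (a * h) ^+ 2 / 2 * g2 (a * x + b) by field.
  apply: (le_trans le).
  rewrite normrM exprMn mulrA ler_wpM2r ?exprn_ge0//.
  by rewrite ler_wpM2l// lerXn2r ?nnegrE ?addr_ge0// lerDr.
Qed.

Lemma test_function_cst a : test_function (cst a).
Proof.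
exists `|a|, (cst 0), (cst 0); split => //=; first by move=> x; rewrite normr0.
by move=> x h; rewrite !mulr0 !addr0 subrr normr0 mulr_ge0.
Qed.

Lemma test_functionD f g : test_function f -> test_function g ->
  test_function (fun x => f x + g x).
Proof.
move=> [C [f1 [f2 [mf1 mf2 fC fT]]]] [D [g1 [g2 [mg1 mg2 gC gT]]]].
exists (C + D), (fun x => f1 x + g1 x), (fun x => f2 x + g2 x); split.
- exact: measurable_funD.
- exact: measurable_funD.
- move=> x; have [? ? ?] := fC x; have [? ? ?] := gC x.
  by split; apply: (le_trans (ler_normD _ _)); apply: lerD.
- move=> x h; rewrite mulrDl; apply: le_trans (lerD (fT x h) (gT x h)).
  by apply: le_trans (ler_normD _ _); rewrite le_eqVlt; apply/orP; left;
    apply/eqP; congr `|_|; lra.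
Qed.

Lemma test_functionZ a g : test_function g -> test_function (fun x => a * g x).
Proof.
move=> [C [g1 [g2 [mg1 mg2 gC gT]]]].
exists (`|a| * C), (fun x => a * g1 x), (fun x => a * g2 x); split.
- exact: measurable_funM.
- exact: measurable_funM.
- by move=> x; have [? ? ?] := gC x; split; rewrite normrM ler_wpM2l.
- move=> x h; rewrite -(mulrA `|a|).
  apply: le_trans (ler_wpM2l (normr_ge0 a) (gT x h)).
  by rewrite -normrM le_eqVlt; apply/orP; left; apply/eqP; congr `|_|; lra.
Qed.

Definition trunc_pow n x := Num.max x 0 ^+ n.

(** The cubes of positive parts are the bricks of cubic splines; where one of
    the two points is negative, the remainder is compared with [h ^+ 3] by
    monotonicity of the cube. *)
Lemma trunc_pow3_taylor x h :
  `|trunc_pow 3 (x + h) - (trunc_pow 3 x + h * (3 * trunc_pow 2 x)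
     + h ^+ 2 / 2 * (6 * trunc_pow 1 x))| <= `|h| ^+ 3.
Proof.
rewrite /trunc_pow -normrX.
case: (leP x 0) => x0; case: (leP (x + h) 0) => y0.
- by rewrite !expr0n/= !(mulr0, addr0, subr0) normr0.
- rewrite !expr0n/= !(mulr0, addr0, subr0).
  have h0 : 0 <= h by lra.
  rewrite !ger0_norm ?exprn_ge0// ?(ltW y0)//.
  by rewrite lerXn2r ?nnegrE ?(ltW y0)//; lra.
- rewrite expr0n/=; have h0 : h < 0 by lra.
  rewrite (ler0_norm (x := h ^+ 3)); last by rewrite exprn_odd_le0// ltW.
  (* with u = - (x + h), the difference is u^3 - |h|^3 and 0 <= u <= |h| *)
  have u0 : 0 <= - (x + h) by lra.
  have u3 : (- (x + h)) ^+ 3 <= (- h) ^+ 3 by rewrite lerXn2r ?nnegrE//; lra.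
  have u4 := exprn_ge0 3 u0.
  rewrite [X in `|X|](_ : _ = (- (x + h)) ^+ 3 - (- h) ^+ 3); last by field.
  by rewrite ler0_norm ?subr_le0//; lra.
- by rewrite le_eqVlt; apply/orP; left; apply/eqP; congr `|_|; field.
Qed.

End test_functions.

(** * A cubic spline step *)

Section spline.
Context {R : realType}.
Implicit Types (x a b : R).

Lemma trunc_pow_le0 n x : x <= 0 -> trunc_pow n.+1 x = 0.
Proof. by move=> x0; rewrite /trunc_pow (max_idPr x0) expr0n. Qed.

Lemma trunc_pow_ge0 n x : 0 <= x -> trunc_pow n x = x ^+ n.
Proof.
rewrite le_eqVlt => /predU1P[<-|x0]; rewrite /trunc_pow ?maxxx//.
by case: leP x0 => // x0 /lt_geF; rewrite x0.
Qed.

Lemma measurable_trunc_pow n : measurable_fun setT (@trunc_pow R n).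
Proof. by apply: measurable_funX; exact: measurable_maxr. Qed.

(** The third difference of a truncated power of degree at most 3 is constant
    on either side of [0, 3]: this localizes the bricks above. *)
Definition third_diff (f : R -> R) x :=
  f x - 3 * f (x - 1) + 3 * f (x - 2) - f (x - 3).

Lemma measurable_third_diff f : measurable_fun setT f ->
  measurable_fun setT (third_diff f).
Proof.
move=> mf; have ms (c : R) : measurable_fun setT (fun x => f (x - c)).
  by apply: measurableT_comp => //; exact: measurable_funB.
by rewrite /third_diff; apply: measurable_funB => //; apply: measurable_funD;
  [apply: measurable_funB => //|]; exact: measurable_funM.
Qed.

(** The distribution function of a sum of three independent uniform variables
    on the unit interval. *)
Definition spline x := third_diff (trunc_pow 3) x / 6.

Lemma third_diff_trunc_powE n x : third_diff (trunc_pow n.+1) x =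
  if x <= 0 then 0 else
  if x <= 1 then x ^+ n.+1 else
  if x <= 2 then x ^+ n.+1 - 3 * (x - 1) ^+ n.+1 else
  if x <= 3 then x ^+ n.+1 - 3 * (x - 1) ^+ n.+1 + 3 * (x - 2) ^+ n.+1 else
  x ^+ n.+1 - 3 * (x - 1) ^+ n.+1 + 3 * (x - 2) ^+ n.+1 - (x - 3) ^+ n.+1.
Proof.
rewrite /third_diff.
case: (leP x 0) => x0.
  by rewrite !trunc_pow_le0 ?mulr0 ?subr0 ?addr0//; lra.
rewrite (trunc_pow_ge0 _ (ltW x0)).
case: (leP x 1) => x1.
  by rewrite !trunc_pow_le0 ?mulr0 ?subr0 ?addr0//; lra.
rewrite (@trunc_pow_ge0 _ (x - 1)); last lra.
case: (leP x 2) => x2.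
  by rewrite !trunc_pow_le0 ?mulr0 ?subr0 ?addr0//; lra.
rewrite (@trunc_pow_ge0 _ (x - 2)); last lra.
case: (leP x 3) => x3; first by rewrite trunc_pow_le0 ?subr0//; lra.
by rewrite trunc_pow_ge0//; lra.
Qed.

Lemma spline0 x : x <= 0 -> spline x = 0.
Proof. by move=> x0; rewrite /spline third_diff_trunc_powE x0 mul0r. Qed.

Lemma spline1 x : 3 <= x -> spline x = 1.
Proof.
move=> x3; rewrite /spline third_diff_trunc_powE.
do 3 (case: leP => [?|_]; first lra).
by case: leP => [?|_]; [have -> : x = 3 by lra|]; field.
Qed.

Lemma spline_itv x : 0 <= spline x <= 1.
Proof.
have cube01 (t : R) : 0 <= t -> t <= 1 -> 0 <= t ^+ 3 <= 1.
  by move=> t0 t1; rewrite exprn_ge0//= exprn_ile1.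
rewrite /spline third_diff_trunc_powE.
case: (leP x 0) => x0; first by rewrite mul0r lexx ler01.
case: (leP x 1) => x1; first by have := cube01 x (ltW x0) x1; lra.
case: (leP x 2) => x2.
  set t := x - 1; have -> : x = t + 1 by rewrite subrK.
  have t0 : 0 <= t by rewrite subr_ge0 ltW.
  have t1 : t <= 1 by rewrite /t; lra.
  have q0 : 0 <= t ^+ 2 * (1 - t) by rewrite mulr_ge0 ?sqr_ge0 ?subr_ge0.
  have q1 : 0 <= (1 - t) * (1 - t ^+ 2).
    by rewrite mulr_ge0 ?subr_ge0// exprn_ile1.
  have t2 : t ^+ 2 <= 1 by rewrite exprn_ile1.
  by have /andP[t3 _] := cube01 t t0 t1; apply/andP; split; lra.
case: (leP x 3) => x3; last lra.
have /cube01/= : 0 <= 3 - x by lra.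
have w1 : 3 - x <= 1 by lra.
by move=> /(_ w1) /andP[q0 q1]; apply/andP; split; lra.
Qed.

(** The expansion is a combination of four expansions of truncated cubes; the
    coefficients 1/6, -1/2, 1/2, -1/6 have absolute values adding up to 4/3. *)
Lemma spline_taylor_bounded : taylor_bounded 2 spline
  (fun x => third_diff (trunc_pow 2) x / 2) (third_diff (trunc_pow 1)).
Proof.
split.
- apply: measurable_funM => //; apply: measurable_third_diff.
  exact: measurable_trunc_pow.
- by apply: measurable_third_diff; exact: measurable_trunc_pow.
- move=> x; split.
  + by have /andP[s0 s1] := spline_itv x; rewrite ger0_norm//; lra.
  + rewrite third_diff_trunc_powE ler_norml.
    case: (leP x 0) => x0; first by rewrite mul0r; apply/andP; split; lra.
    case: (leP x 1) => x1; first by apply/andP; split; nra.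
    case: (leP x 2) => x2; first by apply/andP; split; nra.
    have -> : x ^+ 2 - 3 * (x - 1) ^+ 2 + 3 * (x - 2) ^+ 2 = (3 - x) ^+ 2.
      by ring.
    case: (leP x 3) => x3; first by apply/andP; split; nra.
    by apply/andP; split; lra.
  + rewrite third_diff_trunc_powE ler_norml !expr1.
    case: (leP x 0) => ?; [|case: (leP x 1) => ?; [|case: (leP x 2) => ?;
      [|case: (leP x 3) => ?]]]; by apply/andP; split; lra.
- move=> x h.
  have t0 := trunc_pow3_taylor x h.
  have t1 := trunc_pow3_taylor (x - 1) h.
  have t2 := trunc_pow3_taylor (x - 2) h.
  have t3 := trunc_pow3_taylor (x - 3) h.
  rewrite /spline /third_diff.
  rewrite !(addrAC x h).
  have h3 := exprn_ge0 3 (normr_ge0 h).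
  move: t0 t1 t2 t3; rewrite !ler_norml => /andP[a0 b0] /andP[a1 b1].
  by move=> /andP[a2 b2] /andP[a3 b3]; apply/andP; split; lra.
Qed.

Definition smooth_step a b x := spline (3 / (b - a) * x + - (3 / (b - a) * a)).

Lemma smooth_step_test a b : test_function (smooth_step a b).
Proof.
apply: test_function_affine.
exists 2, (fun x => third_diff (trunc_pow 2) x / 2), (third_diff (trunc_pow 1)).
exact: spline_taylor_bounded.
Qed.

Lemma smooth_step_itv a b x : 0 <= smooth_step a b x <= 1.
Proof. exact: spline_itv. Qed.

Lemma smooth_step0 a b x : a < b -> x <= a -> smooth_step a b x = 0.
Proof.
move=> ab xa; apply: spline0; rewrite -mulrBr mulr_ge0_le0 ?subr_le0//.
by rewrite divr_ge0// subr_ge0 ltW.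
Qed.

Lemma smooth_step1 a b x : a < b -> b <= x -> smooth_step a b x = 1.
Proof.
move=> ab bx; apply: spline1; rewrite -mulrBr mulrAC ler_pdivlMr ?subr_gt0//.
by rewrite ler_wpM2l// lerB.
Qed.

End spline.

(** * Approximation by test functions *)

Section approximation.
Context {R : realType}.
Implicit Types (f : R -> R) (a b d e M : R).

Lemma test_function_continuous f : test_function f -> continuous f.
Proof. by move=> [C [f1 [f2 /taylor_bounded_continuous]]]. Qed.

Lemma test_function_measurable f : test_function f -> measurable_fun setT f.
Proof.
by move=> /test_function_continuous; exact: continuous_measurable_fun.
Qed.

Lemma test_function_bounded f :
  test_function f -> exists C, forall x, `|f x| <= C.
Proof. by move=> [C [f1 [f2 [_ _ fC _]]]]; exists C => x; have [] := fC x. Qed.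

(** Heine's theorem: every point of the segment has a neighbourhood on which
    all small enough radii work, and finitely many of these cover it. *)
Lemma segment_unif_continuous f a b e : continuous f -> 0 < e ->
  exists2 d : R, 0 < d & forall x y : R, a <= x <= b -> `|y - x| <= d ->
    `|f y - f x| <= e.
Proof.
move=> cf e0.
have /compact_near_coveringP cpt := @segment_compact R a b.
pose Q (d x : R) := forall y, `|y - x| <= d -> `|f y - f x| <= e.
have : \forall d \near (0 : R)^'+, `[a, b]%classic `<=` Q d.
  apply: cpt => x _.
  have e20 : 0 < e / 2 by rewrite divr_gt0.
  have /cvgrPdist_le/(_ _ e20)[/= r r0 fr] := cf x.
  near=> x' d => y yx'.
  have x'r : `|x - x'| < r / 2.
    by near: x'; exists (r / 2) => //=; rewrite divr_gt0.
  have dr : d < r / 2 by near: d; apply: nbhs_right_lt; rewrite divr_gt0.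
  have fx' : `|f x - f x'| <= e / 2 by apply: fr => /=; lra.
  have fy : `|f x - f y| <= e / 2.
    apply: fr => /=; have -> : x - y = (x - x') - (y - x') by ring.
    by move: yx' => /= yx'; rewrite (le_lt_trans (ler_normB _ _))//; lra.
  have -> : f y - f x' = (f x - f x') - (f x - f y) by ring.
  by rewrite (le_trans (ler_normB _ _))//; lra.
move=> near0.
have : \forall d \near (0 : R)^'+, 0 < d /\ `[a, b]%classic `<=` Q d.
  near=> d; split; first by near: d; exact: nbhs_right_gt.
  by near: d.
move=> /filter_ex[d [d0 fd]]; exists d => // x y xab.
by apply: fd; rewrite /= in_itv.
Unshelve. all: by end_near. Qed.

(** On the mesh a, a + d, ..., a + N d, the approximant jumps smoothly from
    one value of [f] to the next.  On each cell it is a convex combination of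
    the values of [f] at both ends; it stays at the last value afterwards,
    which is what allows one more cell to be added. *)
Lemma test_function_approx_mesh f M a d e N : continuous f ->
  (forall x, `|f x| <= M) -> 0 < d ->
  (forall x y : R, a <= x <= a + N%:R * d -> `|y - x| <= d ->
    `|f y - f x| <= e) ->
  exists g, [/\ test_function g, forall x, `|g x| <= M,
    forall x : R, a + N%:R * d <= x -> g x = f (a + N%:R * d) &
    forall x : R, a <= x <= a + N%:R * d -> `|f x - g x| <= e].
Proof.
move=> cf fM d0; elim: N => [|N IH] fd.
  exists (cst (f a)); split => //=.
  - exact: test_function_cst.
  - by move=> x _; rewrite mul0r addr0.
  - move=> x; rewrite mul0r addr0 => xa; have -> : x = a by lra.
    rewrite subrr normr0 (le_trans (normr_ge0 (f a - f a)))// fd//.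
      by rewrite mul0r; lra.
    by rewrite subrr normr0 ltW.
set u := a + N%:R * d in IH; set v := a + N.+1%:R * d in fd *.
have vu : v = u + d by rewrite /v /u -natr1 mulrDl mul1r addrA.
have au : a <= u by rewrite /u lerDl mulr_ge0// ltW.
have uv : u < v by rewrite vu ltrDl.
have [g [tg gM gu gf]] : exists g, [/\ test_function g, forall x, `|g x| <= M,
    forall x : R, u <= x -> g x = f u &
    forall x : R, a <= x <= u -> `|f x - g x| <= e].
  by apply: IH => x y xau; apply: fd; lra.
pose s := smooth_step u v.
have gE x : x <= u -> g x + (f v - f u) * s x = g x.
  by move=> xu; rewrite /s smooth_step0// mulr0 addr0.
exists (fun x => g x + (f v - f u) * s x); split.
- apply: test_functionD => //; apply: test_functionZ.
  exact: smooth_step_test.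
- move=> x; case: (leP x u) => xu; first by rewrite gE.
  rewrite gu ?(ltW xu)//.
  have := smooth_step_itv u v x; rewrite -/s => /andP[s0 s1].
  have := fM u; have := fM v; rewrite !ler_norml => /andP[v0 v1] /andP[u0 u1].
  by apply/andP; split; nra.
- by move=> x vx; rewrite /s smooth_step1// mulr1 gu ?subrKC//; lra.
- move=> x /andP[ax xv]; case: (leP x u) => xu.
    by rewrite gE// gf// ax.
  rewrite gu ?(ltW xu)//.
  have := smooth_step_itv u v x; rewrite -/s => /andP[s0 s1].
  have fu : `|f u - f x| <= e.
    apply: fd; first by rewrite ax xv.
    by rewrite distrC ger0_norm; lra.
  have fv : `|f v - f x| <= e.
    apply: fd; first by rewrite ax xv.
    by rewrite ger0_norm; lra.
  move: fu fv; rewrite !ler_norml => /andP[u0 u1] /andP[v0 v1].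
  by apply/andP; split; nra.
Qed.

Lemma test_function_approx f M a b e : a <= b -> continuous f ->
  (forall x, `|f x| <= M) -> 0 < e -> exists g,
  [/\ test_function g, forall x, `|g x| <= M &
      forall x : R, a <= x <= b -> `|f x - g x| <= e].
Proof.
move=> ab cf fM e0.
(* the mesh may go past b, but by at most one step, kept below 1 *)
have [d d0 fd] := segment_unif_continuous a (b + 1) cf e0.
pose c := Num.min d 1.
have c0 : 0 < c by rewrite lt_min d0 ltr01.
have [cd c1] : c <= d /\ c <= 1 by rewrite !ge_min !lexx orbT.
pose N := (Num.truncn ((b - a) / c)).+1.
have bN : b <= a + N%:R * c.
  by rewrite -lerBlDl -ler_pdivrMr// ltW// truncnS_gt.
have Nb : a + N%:R * c <= b + 1.
  have : (Num.truncn ((b - a) / c))%:R * c <= b - a.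
    by rewrite -ler_pdivlMr// truncn_le// divr_ge0 ?subr_ge0// ltW.
  by rewrite /N -natr1; lra.
have [|g [tg gM _ fg]] := @test_function_approx_mesh f M a c e N cf fM c0.
  by move=> x y /andP[ax xN] yx; apply: fd; lra.
by exists g; split => // x /andP[ax xb]; apply: fg; lra.
Qed.

End approximation.

(** * Expectations of bounded variables *)

Section expectation.
Context d (T : measurableType d) (R : realType) (P : probability T R).
Implicit Types (X Y : T -> R) (g : R -> R) (C : R).

Lemma bounded_integrable X C : measurable_fun setT X ->
  (forall t, `|X t| <= C) -> P.-integrable setT (EFin \o X).
Proof.
move=> mX XC; apply: measurable_bounded_integrable => //.
  by rewrite (le_lt_trans (probability_le1 _ _)) ?ltry.
exists C; split; first exact: num_real.
by move=> x Cx t _ /=; rewrite (le_trans (XC t))// ltW.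
Qed.

Lemma integrable_EFin_cst (c : R) : P.-integrable setT (EFin \o (fun=> c)).
Proof. by apply: (@bounded_integrable (fun=> c) `|c|). Qed.

Lemma integrable_EFinD X Y : P.-integrable setT (EFin \o X) ->
  P.-integrable setT (EFin \o Y) ->
  P.-integrable setT (EFin \o (fun t => X t + Y t)).
Proof. by move=> iX iY; exact: (integrableD measurableT iX iY). Qed.

Lemma integrable_EFinB X Y : P.-integrable setT (EFin \o X) ->
  P.-integrable setT (EFin \o Y) ->
  P.-integrable setT (EFin \o (fun t => X t - Y t)).
Proof. by move=> iX iY; exact: (integrableB measurableT iX iY). Qed.

Lemma integrable_EFinZ (c : R) X : P.-integrable setT (EFin \o X) ->
  P.-integrable setT (EFin \o (fun t => c * X t)).
Proof. by move=> iX; exact: (integrableZl measurableT c iX). Qed.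

Lemma test_function_integrable g X : test_function g -> measurable_fun setT X ->
  P.-integrable setT (EFin \o (g \o X)).
Proof.
move=> tg mX; have [C gC] := test_function_bounded tg.
apply: (@bounded_integrable _ C) => // t; last exact: gC.
apply: measurableT_comp => //; exact: test_function_measurable.
Qed.

Lemma expectation_Rintegral X : P.-integrable setT (EFin \o X) ->
  ('E_P[X] = (\int[P]_t X t)%:E)%E.
Proof.
by move=> iX; rewrite unlock /Rintegral fineK//; exact: integrable_fin_num.
Qed.

Lemma Rintegral_probability_cst (c : R) : \int[P]_t c = c.
Proof. by rewrite Rintegral_cst//= probability_setT mulr1. Qed.

End expectation.

(** * Weak convergence from test functions *)

Section portmanteau.
Context d (T : measurableType d) d' (T' : measurableType d') (R : realType).
Variables (P : probability T R) (P' : probability T' R).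
Variables (Y : nat -> {RV P >-> R}) (Z : {RV P' >-> R}).

Implicit Types (K x e M : R) (f g : R -> R).

(** Vanishes on [-K, K] and is at least 1 outside [-K - 1, K + 1]. *)
Definition tail_bump (K : R) (x : R) :=
  1 - smooth_step (- K - 1) (- K) x + smooth_step K (K + 1) x.

Lemma tail_bump_test K : test_function (tail_bump K).
Proof.
apply: test_functionD; last exact: smooth_step_test.
apply: test_functionD; first exact: test_function_cst.
rewrite [X in test_function X](_ : _ =
    (fun x => -1 * smooth_step (- K - 1) (- K) x)).
  exact/test_functionZ/smooth_step_test.
by apply/funext => x; rewrite mulN1r.
Qed.

Lemma tail_bump_ge0 K x : 0 <= tail_bump K x.
Proof.
rewrite /tail_bump.
have := smooth_step_itv (- K - 1) (- K) x; have := smooth_step_itv K (K + 1) x.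
by lra.
Qed.

Lemma tail_bump_le2 K x : tail_bump K x <= 2.
Proof.
rewrite /tail_bump.
have := smooth_step_itv (- K - 1) (- K) x; have := smooth_step_itv K (K + 1) x.
by lra.
Qed.

Lemma tail_bump_inner K x : `|x| <= K -> tail_bump K x = 0.
Proof.
rewrite ler_norml => /andP[Kx xK].
by rewrite /tail_bump smooth_step1 ?smooth_step0//; lra.
Qed.

Lemma tail_bump_outer K x : 0 <= K -> K + 1 <= `|x| -> 1 <= tail_bump K x.
Proof.
move=> K0; rewrite /tail_bump.
have := smooth_step_itv (- K - 1) (- K) x; have := smooth_step_itv K (K + 1) x.
case: (leP 0 x) => x0; last rewrite ltr0_norm// => ? ?.
  by rewrite ger0_norm// => ? ? Kx; rewrite (smooth_step1 _ Kx)//; lra.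
by move=> Kx; rewrite (@smooth_step0 _ (- K - 1))//; lra.
Qed.

Lemma tail_bump_small e : 0 < e ->
  exists2 K, 0 <= K & \int[P']_t tail_bump K (Z t) < e.
Proof.
move=> e0.
have mtail n : measurable_fun setT (fun t => tail_bump n (Z t)).
  apply: (@measurableT_comp _ _ _ _ _ _ (tail_bump n)) => //.
  by apply: test_function_measurable; exact: tail_bump_test.
have [|||||_ _ +] := @dominated_convergence _ _ _ P' setT measurableT
  (fun n t => (tail_bump n%:R (Z t))%:E) (cst 0%E) (cst 2%:E).
- by move=> n; exact/measurable_EFinP.
- exact: measurable_cst.
- apply/aeW => t _.
  apply: cvg_near_cst; near=> n; rewrite tail_bump_inner//.
  by near: n; exact: nbhs_infty_ger.
- apply: (@bounded_integrable _ _ _ P' (cst 2) 2) => //= t.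
  by rewrite ger0_norm.
- apply/aeW => t n _.
  by rewrite lee_fin ger0_norm ?tail_bump_ge0// tail_bump_le2.
rewrite integral0 => /fine_cvg/cvgrPdist_lt/(_ _ e0)/filter_ex[n].
rewrite /= sub0r normrN => ne; exists n%:R => //.
exact: le_lt_trans (ler_norm _) ne.
Unshelve. all: by end_near. Qed.

(** The bump absorbs the region where [g] does not approximate [f]: there
    both are bounded by [M]. *)
Lemma expectation_approx_error K f g M e d0 (T0 : measurableType d0)
    (Q : probability T0 R) (W : {RV Q >-> R}) :
  test_function g -> continuous f -> 0 <= K -> 0 <= e ->
  (forall x, `|f x| <= M) -> (forall x, `|g x| <= M) ->
  (forall x, - K - 1 <= x <= K + 1 -> `|f x - g x| <= e) ->
  `|\int[Q]_t f (W t) - \int[Q]_t g (W t)| <=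
    e + 2 * M * \int[Q]_t tail_bump K (W t).
Proof.
move=> tg cf K0 e0 fM gM fg.
have M0 : 0 <= M by rewrite (le_trans _ (fM 0)).
have mf : measurable_fun setT (f \o W).
  by apply: measurableT_comp => //; exact: continuous_measurable_fun.
have itf : Q.-integrable setT (EFin \o (f \o W)).
  by apply: (@bounded_integrable _ _ _ Q _ M mf) => t; exact: fM.
have itg := test_function_integrable Q tg (@measurable_funPT _ _ _ _ W).
have itb := test_function_integrable Q (tail_bump_test K)
  (@measurable_funPT _ _ _ _ W).
have itMb : Q.-integrable setT (EFin \o (fun t => 2 * M * tail_bump K (W t))).
  exact: (@test_function_integrable _ _ _ _ (fun x => 2 * M * tail_bump K x) W
    (test_functionZ _ (tail_bump_test K))).
have ite : Q.-integrable setT (EFin \o cst e).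
  exact: integrable_EFin_cst.
rewrite -RintegralB// (le_trans (le_normr_Rintegral _ _))//.
  exact: integrable_EFinB.
rewrite -[X in X + _](Rintegral_probability_cst Q e).
rewrite -RintegralZl// -RintegralD//.
apply: le_Rintegral => //.
- by apply: integrable_norm; exact: integrable_EFinB.
- exact: integrable_EFinD.
- move=> t _ /=; have [Wt|Wt] := leP (K + 1) `|W t|.
    have := tail_bump_outer K0 Wt.
    have := fM (W t); have := gM (W t) => gm fm b1.
    rewrite (le_trans (ler_normB _ _))//; nra.
  rewrite (le_trans (fg _ _))//.
    by move: Wt; rewrite ltr_norml; lra.
  by rewrite lerDl mulr_ge0 ?tail_bump_ge0// mulr_ge0.
Qed.

(** The bump is itself a test function, so its expectation under [Y n] is
    eventually almost as small as under [Z]: this stands in for tightness. *)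
Lemma converges_weakly_test :
  (forall g, test_function g ->
    (\int[P]_t g (Y n t) @[n --> \oo] --> \int[P']_t g (Z t))) ->
  converges_weakly Y Z.
Proof.
move=> Yg f cf fb.
have [M fM] : exists M, forall x, `|f x| <= M.
  case: fb => M [_ /(_ (M + 1))]; rewrite ltrDl ltr01 => /(_ isT) fM.
  by exists (M + 1) => x; exact: fM.
have intf d0 (T0 : measurableType d0) (Q : probability T0 R)
    (W : {RV Q >-> R}) :
    Q.-integrable setT (EFin \o (f \o W)).
  apply: (@bounded_integrable _ _ _ Q _ M) => [|t]; last exact: fM.
  by apply: measurableT_comp => //; exact: continuous_measurable_fun.
under eq_fun do rewrite expectation_Rintegral//.
rewrite expectation_Rintegral//; apply: cvg_EFin; first exact: nearW.
have M0 : 0 <= M by rewrite (le_trans _ (fM 0)).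
apply/cvgrPdist_le => /= e e0.
(* the errors for Y n and Z and the distance of the expectations of g add up
   to at most (c + 4 M c) + (c + 2 M c) + c *)
pose c := e / (3 + 6 * M).
have c0 : 0 < c by rewrite divr_gt0// ltr_wpDr// mulr_ge0.
have ce : (3 + 6 * M) * c = e.
  by rewrite mulrC divfK// gt_eqF// ltr_wpDr// mulr_ge0.
have [K K0 tailK] := tail_bump_small c0.
have [|g [tg gM fg]] :=
  @test_function_approx _ f M (- K - 1) (K + 1) c _ cf fM c0.
  lra.
have /cvgrPdist_le/(_ _ c0) gn := Yg _ tg.
have /cvgrPdist_le/(_ _ c0) bn := Yg _ (tail_bump_test K).
near=> n.
have gn1 : `|\int[P']_t g (Z t) - \int[P]_t g (Y n t)| <= c by near: n.
have bn1 : `|\int[P']_t tail_bump K (Z t) - \int[P]_t tail_bump K (Y n t)| <= c.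
  by near: n.
have := expectation_approx_error Z tg cf K0 (ltW c0) fM gM fg.
have := expectation_approx_error (Y n) tg cf K0 (ltW c0) fM gM fg.
move: gn1 bn1; rewrite !ler_norml => /andP[g1 g2] /andP[b1 b2].
move=> /andP[a1 a2] /andP[d1 d2].
have m1 : 2 * M * \int[P']_t tail_bump K (Z t) <= 2 * M * c.
  by rewrite ler_wpM2l ?mulr_ge0// ltW.
have m2 : 2 * M * \int[P]_t tail_bump K (Y n t) <= 2 * M * (2 * c).
  by rewrite ler_wpM2l ?mulr_ge0//; lra.
by apply/andP; split; lra.
Unshelve. all: by end_near. Qed.

End portmanteau.

(** * Averaging over a small centred perturbation *)

Section lindeberg_remainder.
Context {R : realType}.
Implicit Types (x h v C : R) (g : R -> R).

(** The size of the Taylor remainder: the cubic bound is used for small [h]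
    and the quadratic one, which needs only boundedness, for large [h].  This
    is what makes finite variance sufficient. *)
Definition lindeberg_fun h : R := h ^+ 2 * Num.min 1 `|h|.

Lemma lindeberg_fun_ge0 h : 0 <= lindeberg_fun h.
Proof. by rewrite mulr_ge0 ?sqr_ge0// le_min ler01 normr_ge0. Qed.

Lemma lindeberg_fun_le_sqr h : lindeberg_fun h <= h ^+ 2.
Proof. by rewrite ler_piMr ?sqr_ge0// ge_min lexx. Qed.

Lemma measurable_lindeberg_fun : measurable_fun setT lindeberg_fun.
Proof.
apply: measurable_funM; first exact: measurable_funX.
by apply: measurable_minr => //; exact: measurable_normr.
Qed.

Lemma taylor_remainder C g g1 g2 x h : taylor_bounded C g g1 g2 ->
  `|g (x + h) - (g x + h * g1 x + h ^+ 2 / 2 * g2 x)|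
    <= 4 * C * lindeberg_fun h.
Proof.
move=> tg; have C0 := taylor_bounded_ge0 tg; case: tg => _ _ gC gT.
rewrite /lindeberg_fun; have hn := real_normK (num_real h).
case: (leP 1 `|h|) => h1.
  have [gx g1x g2x] := gC x; have [gxh _ _] := gC (x + h).
  have a1 : `|h * g1 x| <= `|h| * C by rewrite normrM ler_wpM2l.
  have a2 : `|h ^+ 2 / 2 * g2 x| <= `|h| ^+ 2 / 2 * C.
    rewrite normrM normrM normrX (ger0_norm (x := 2^-1))//.
    by rewrite ler_wpM2l// divr_ge0// exprn_ge0.
  have h2 : `|h| <= `|h| ^+ 2 by rewrite expr2 ler_peMr.
  rewrite mulr1; apply: (le_trans (ler_normB _ _)).
  have := ler_normD (g x + h * g1 x) (h ^+ 2 / 2 * g2 x).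
  have := ler_normD (g x) (h * g1 x).
  have := ler_wpM2l C0 h2.
  have := ler_wpM2l C0 h1.
  have : C * `|h| ^+ 2 = C * h ^+ 2 by rewrite hn.
  by lra.
have -> : h ^+ 2 * `|h| = `|h| ^+ 3 by rewrite -hn -exprSr.
apply: (le_trans (gT x h)); rewrite ler_wpM2r ?exprn_ge0//.
by lra.
Qed.

End lindeberg_remainder.

Section one_step.
Context d (T : measurableType d) (R : realType) (P : probability T R).
Variables (Y : T -> R) (v C : R) (g g1 g2 : R -> R).
Implicit Types (G : R -> R) (K x : R).
Hypothesis mY : measurable_fun setT Y.
Hypothesis iY2 : P.-integrable setT (EFin \o (fun t => Y t ^+ 2)).
Hypothesis tg : taylor_bounded C g g1 g2.

Lemma sqr_integrable_integrable : P.-integrable setT (EFin \o Y).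
Proof.
have i1 := integrable_EFin_cst P 1.
apply: (le_integrable measurableT _ _ (integrable_EFinD i1 iY2)).
  exact/measurable_EFinP.
move=> t _ /=; rewrite lee_fin [leRHS]ger0_norm ?addr_ge0 ?sqr_ge0//.
by rewrite -(real_normK (num_real (Y t))); have := normr_ge0 (Y t); nra.
Qed.

Lemma measurable_translate G x : measurable_fun setT G ->
  measurable_fun setT (fun t => G (x + Y t)).
Proof.
by move=> mG; apply: measurableT_comp => //; exact: measurable_funD.
Qed.

Lemma translate_integrable G K x : measurable_fun setT G ->
  (forall x, `|G x| <= K) ->
  P.-integrable setT (EFin \o (fun t => G (x + Y t))).
Proof.
move=> mG GK; apply: (@bounded_integrable _ _ _ _ _ K) => //.
exact: measurable_translate.
Qed.

Lemma lindeberg_fun_integrable :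
  P.-integrable setT (EFin \o (fun t => lindeberg_fun (Y t))).
Proof.
apply: (le_integrable measurableT _ _ iY2).
  by apply/measurable_EFinP; apply: measurableT_comp mY => //;
    exact: measurable_lindeberg_fun.
move=> t _ /=; rewrite lee_fin !ger0_norm ?sqr_ge0 ?lindeberg_fun_ge0//.
exact: lindeberg_fun_le_sqr.
Qed.

(** The linear term of the expansion integrates to 0, the quadratic one to
    half the variance. *)
Lemma translate_expectation x :
  \int[P]_t Y t = 0 -> \int[P]_t Y t ^+ 2 = v ->
  `|\int[P]_t g (x + Y t) - (g x + v / 2 * g2 x)|
    <= 4 * C * \int[P]_t lindeberg_fun (Y t).
Proof.
move=> EY EY2.
have [_ _ gC _] := tg.
have iY := sqr_integrable_integrable.
have ig : P.-integrable setT (EFin \o (fun t => g (x + Y t))).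
  apply: (@translate_integrable _ C); first exact: taylor_bounded_measurable tg.
  by move=> y; have [] := gC y.
pose q t := g x + g1 x * Y t + g2 x / 2 * Y t ^+ 2.
have i1 := integrable_EFin_cst P (g x).
have i2 : P.-integrable setT (EFin \o (fun t => g1 x * Y t)).
  exact: integrable_EFinZ.
have i3 : P.-integrable setT (EFin \o (fun t => g2 x / 2 * Y t ^+ 2)).
  exact: (integrable_EFinZ _ iY2).
have iq : P.-integrable setT (EFin \o q).
  by apply: integrable_EFinD => //; exact: integrable_EFinD.
have -> : g x + v / 2 * g2 x = \int[P]_t q t.
  rewrite RintegralD//; last exact: integrable_EFinD.
  rewrite RintegralD// RintegralZl// EY RintegralZl//.
  by rewrite EY2 (Rintegral_probability_cst P (g x)); ring.
rewrite -RintegralB//; apply: le_trans (le_normr_Rintegral _ _) _ => //.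
  exact: integrable_EFinB.
rewrite -RintegralZl//; last exact: lindeberg_fun_integrable.
apply: le_Rintegral => //.
- by apply: integrable_norm; exact: integrable_EFinB.
- exact/integrable_EFinZ/lindeberg_fun_integrable.
- move=> t _; have := taylor_remainder x (Y t) tg.
  by rewrite /q; congr (`|_| <= _); ring.
Qed.

(** Tonelli's theorem gives measurability for nonnegative integrands, hence
    the shift by [K]. *)
Lemma measurable_average G K : measurable_fun setT G ->
  (forall x, `|G x| <= K) ->
  measurable_fun setT (fun x => \int[P]_t G (x + Y t)).
Proof.
move=> mG GK.
pose h (z : R * T) := (G (z.1 + Y z.2) + K)%:E.
have mh : measurable_fun setT h.
  apply/measurable_EFinP; apply: measurable_funD => //.
  apply: measurableT_comp => //; apply: measurable_funD => //.
  exact: measurableT_comp.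
have h0 z : (0 <= h z)%E.
  by rewrite lee_fin; have := GK (z.1 + Y z.2); rewrite ler_norml; lra.
have mF := measurable_fun_fubini_tonelli_F (m2 := P) h mh h0.
have -> : (fun x => \int[P]_t G (x + Y t)) =
    (fun x => fine (fubini_F P h x) - K).
  apply/funext => x; rewrite /fubini_F /h/=.
  have iG := translate_integrable x mG GK.
  have iK := integrable_EFin_cst P K.
  have := RintegralD measurableT iG iK; rewrite {1}/Rintegral/= => ->.
  by rewrite (Rintegral_probability_cst P K) addrK.
apply: measurable_funB => //.
exact: (measurableT_comp _ mF).
Qed.

Lemma le_average G K x : measurable_fun setT G -> (forall x, `|G x| <= K) ->
  `|\int[P]_t G (x + Y t)| <= K.
Proof.
move=> mG GK; have iG := translate_integrable x mG GK.
apply: le_trans (le_normr_Rintegral _ _) _ => //.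
rewrite -[leRHS](Rintegral_probability_cst P K); apply: le_Rintegral => //.
- exact: integrable_norm.
- exact: integrable_EFin_cst.
Qed.

(** By linearity of the integral and the triangle inequality, the bounds and
    the expansion pass to averages of translates with the same constant. *)
Lemma taylor_bounded_average : taylor_bounded C
  (fun x => \int[P]_t g (x + Y t)) (fun x => \int[P]_t g1 (x + Y t))
  (fun x => \int[P]_t g2 (x + Y t)).
Proof.
have mg := taylor_bounded_measurable tg.
have [mg1 mg2 gC gT] := tg.
have g0C x : `|g x| <= C by have [] := gC x.
have g1C x : `|g1 x| <= C by have [] := gC x.
have g2C x : `|g2 x| <= C by have [] := gC x.
split.
- exact: measurable_average g1C.
- exact: measurable_average g2C.
- by move=> x; split; exact: le_average.
- move=> x h.
  have i0 := translate_integrable (x + h) mg g0C.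
  have i1 := translate_integrable x mg g0C.
  have i2 := integrable_EFinZ h (translate_integrable x mg1 g1C).
  have i3 := integrable_EFinZ (h ^+ 2 / 2) (translate_integrable x mg2 g2C).
  rewrite -!RintegralZl//; try exact: translate_integrable g1C;
    try exact: translate_integrable g2C.
  have i12 := integrable_EFinD i1 i2; have i123 := integrable_EFinD i12 i3.
  rewrite -RintegralD// -RintegralD// -RintegralB//.
  apply: le_trans (le_normr_Rintegral _ _) _ => //.
    exact: integrable_EFinB.
  rewrite -[leRHS](Rintegral_probability_cst P); apply: le_Rintegral => //.
  + by apply: integrable_norm; exact: integrable_EFinB.
  + exact: integrable_EFin_cst.
  + by move=> t _; rewrite (addrAC x h).
Qed.

End one_step.

(** * The standard normal law *)

Section gaussian.
Context {R : realType}.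
Local Notation lambda := (@lebesgue_measure R).
Local Notation phi := (normal_pdf 0 1 : R -> R).
Implicit Types (f : R -> \bar R) (g : R -> R) (m s x : R).

(** The density agrees almost everywhere with the Radon-Nikodym derivative, so
    the change of measure along the latter can be used. *)
Lemma ge0_integral_normal_prob m s f : measurable_fun setT f ->
  (forall x, 0 <= f x)%E ->
  (\int[normal_prob m s]_x f x =
   \int[lambda]_x (f x * (normal_pdf m s x)%:E))%E.
Proof.
move=> mf f0; have dom := normal_prob_dominates m s.
rewrite -(Radon_Nikodym_SigmaFinite.change_of_variables dom)//.
apply: ae_eq_integral => //.
- apply: emeasurable_funM => //.
  exact: measurable_int (Radon_Nikodym_SigmaFinite.f_integrable dom).
- apply: emeasurable_funM => //; apply/measurable_EFinP.
  exact: measurable_normal_pdf.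
- apply: ae_eqe_mul2l; apply: integral_ae_eq => //.
  + exact: Radon_Nikodym_SigmaFinite.f_integrable.
  + by apply/measurable_EFinP; exact: measurable_normal_pdf.
  + by move=> A _ mA; rewrite -Radon_Nikodym_SigmaFinite.f_integral.
Qed.

Lemma affine_is_derive a b x : is_derive x (1 : R) (fun y : R => a * y + b) a.
Proof.
apply: is_derive_eq => /=.
by rewrite addr0 /GRing.scale/= mulr1.
Qed.

Lemma affine_derive1 a b : (fun y : R => a * y + b)^`()%classic = cst a.
Proof.
apply/funext => x.
by rewrite derive1E (@derive_val _ _ _ _ _ _ _ (affine_is_derive a b x)).
Qed.

Lemma ge0_integral_affine (a b : R) g : 0 < a -> continuous g ->
  (forall x, 0 <= g x) ->
  (\int[lambda]_x (g x)%:E = \int[lambda]_x (g (a * x + b)%R * a)%:E)%E.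
Proof.
move=> a0 cg g0.
rewrite (@increasing_ge0_integration_by_substitutionT _
  (fun y : R => a * y + b) g)//.
- by apply: eq_integral => x _; rewrite affine_derive1.
- by move=> x y xy; rewrite ltrD2r ltr_pM2l.
- by rewrite affine_derive1; exact: cst_continuous.
- by rewrite affine_derive1; exact: is_cvg_cst.
- by rewrite affine_derive1; exact: is_cvg_cst.
- apply: (@cvg_comp _ _ _ (fun y => a * y) (fun y => y + b) _ -oo).
    exact: gt0_cvgMrNy.
  exact: cvg_addrr_Ny.
- apply: (@cvg_comp _ _ _ (fun y => a * y) (fun y => y + b) _ +oo).
    exact: gt0_cvgMry.
  exact: cvg_addrr.
Qed.

Lemma normal_pdf_gt0E m s x : 0 < s -> normal_pdf m s x =
  (s * Num.sqrt (2 * pi))^-1 * expR (- (x - m) ^+ 2 / (2 * s ^+ 2)).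
Proof.
move=> s0; rewrite normal_pdfE ?gt_eqF// /normal_peak /normal_fun.
have -> : s ^+ 2 * pi *+ 2 = s ^+ 2 * (2 * pi) by rewrite -mulr_natr; ring.
rewrite sqrtrM ?sqr_ge0// sqrtr_sqr gtr0_norm//.
by congr (_ * expR (_ / _)); rewrite mulr_natl.
Qed.

Lemma sqrt2pi_gt0 : 0 < Num.sqrt (2 * pi) :> R.
Proof. by rewrite sqrtr_gt0 mulr_gt0// pi_gt0. Qed.

Lemma normal_pdf_affine (a w y : R) : 0 < a ->
  normal_pdf w a (a * y + w) * a = phi y.
Proof.
move=> a0; have k0 := sqrt2pi_gt0.
rewrite !normal_pdf_gt0E// mulrAC; congr (_ * expR _).
  by field; rewrite !gt_eqF.
by field; rewrite gt_eqF.
Qed.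

Lemma ge0_expectation_normal_affine (a w : R) g : 0 < a -> continuous g ->
  (forall x, 0 <= g x) ->
  (\int[normal_prob (0 : R) 1]_y (g (a * y + w)%R)%:E
   = \int[lambda]_t (g t * normal_pdf w a t)%:E)%E.
Proof.
move=> a0 cg g0.
have mg : measurable_fun setT (fun y : R => g (a * y + w)).
  apply: (@measurableT_comp _ _ _ _ _ _ g).
    exact: continuous_measurable_fun.
  by apply: measurable_funD => //; exact: measurable_funM.
rewrite ge0_integral_normal_prob;
  [|exact/measurable_EFinP|by move=> x; rewrite lee_fin].
rewrite [RHS](@ge0_integral_affine a w
  (fun t => g t * normal_pdf w a t))//.
- by apply: eq_integral => y _; rewrite -mulrA normal_pdf_affine// EFinM.
- move=> t; apply: cvgM; first exact: cg.
  by apply: continuous_normal_pdf; rewrite gt_eqF.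
- by move=> x; rewrite mulr_ge0// normal_pdf_ge0.
Qed.

(** Completing the square in [z]: the joint density of two normal variables
    splits into the density of their sum and a conditional normal density. *)
Lemma normal_pdf_convolution (a b c t z : R) : 0 < a -> 0 < c ->
  c ^+ 2 = a ^+ 2 + b ^+ 2 ->
  normal_pdf (b * z) a t * phi z =
  normal_pdf 0 c t * normal_pdf (t * b / c ^+ 2) (a / c) z.
Proof.
move=> a0 c0 cab; have k0 := sqrt2pi_gt0.
rewrite !normal_pdf_gt0E ?divr_gt0//.
rewrite mulrACA [RHS]mulrACA -!expRD.
congr (_ * expR _); first by field; rewrite !gt_eqF.
have ab : c ^+ 2 - b ^+ 2 != 0 by rewrite cab addrK gt_eqF// exprn_gt0.
have -> : (a / c) ^+ 2 = (c ^+ 2 - b ^+ 2) / c ^+ 2.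
  by rewrite cab addrK exprMn exprVn -cab.
have -> : a ^+ 2 = c ^+ 2 - b ^+ 2 by rewrite cab addrK.
by field; rewrite ab gt_eqF.
Qed.

(** After Tonelli's theorem the conditional density of [normal_pdf_convolution]
    integrates to 1. *)
Lemma ge0_normal_convolution (a b c : R) g : 0 < a -> 0 < c ->
  c ^+ 2 = a ^+ 2 + b ^+ 2 -> continuous g -> (forall x, 0 <= g x) ->
  (\int[normal_prob (0 : R) 1]_z
      \int[normal_prob (0 : R) 1]_y (g (a * y + b * z)%R)%:E
   = \int[normal_prob (0 : R) 1]_y (g (c * y)%R)%:E)%E.
Proof.
move=> a0 c0 cab cg g0.
have mg : measurable_fun setT g by exact: continuous_measurable_fun.
pose k (zt : measurableTypeR R * measurableTypeR R) : R :=
  g zt.2 * normal_pdf (b * zt.1) a zt.2.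
pose h (zt : measurableTypeR R * measurableTypeR R) : R := k zt * phi zt.1.
have mk : measurable_fun setT k.
  apply: measurable_funM; first exact: measurableT_comp.
  under eq_fun do rewrite normal_pdf_gt0E//.
  apply: measurable_funM => //; apply: measurableT_comp => //.
  apply: measurable_funM => //; apply: measurableT_comp => //.
  apply: measurable_funX; apply: measurable_funB => //.
  exact: measurable_funM.
have mh : measurable_fun setT h.
  apply: measurable_funM => //.
  by apply: measurableT_comp => //; exact: measurable_normal_pdf.
have k0 zt : (0 <= (k zt)%:E)%E by rewrite lee_fin mulr_ge0// normal_pdf_ge0.
have h0 zt : (0 <= (h zt)%:E)%E by rewrite lee_fin !mulr_ge0// normal_pdf_ge0.
have E z : ((\int[lambda]_t (k (z, t))%:E) * (phi z)%:E =
    \int[lambda]_t (h (z, t))%:E)%E.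
  apply: esym; transitivity (\int[lambda]_t
      ((k (z, t))%:E * (phi z)%:E)%E)%E.
    by apply: eq_integral => t _; rewrite -EFinM.
  rewrite ge0_integralZr//.
  - by apply/measurable_EFinP; exact: measurableT_comp.
  - by rewrite lee_fin normal_pdf_ge0.
transitivity (\int[normal_prob (0 : R) 1]_z \int[lambda]_t (k (z, t))%:E)%E.
  by apply: eq_integral => z _; exact: ge0_expectation_normal_affine.
have mK : measurable_fun setT (fun z => \int[lambda]_t (k (z, t))%:E)%E.
  apply: (measurable_fun_fubini_tonelli_F (m2 := lambda) (EFin \o k)) => //.
  exact/measurable_EFinP.
rewrite [LHS]ge0_integral_normal_prob//; last by move=> z; exact: integral_ge0.
transitivity (\int[lambda]_z \int[lambda]_t (h (z, t))%:E)%E.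
  by apply: eq_integral => z _; rewrite E.
rewrite (@fubini_tonelli _ _ _ _ _ lambda lambda (EFin \o h))//; last first.
  exact/measurable_EFinP.
transitivity (\int[lambda]_t (g t * normal_pdf 0 c t)%:E)%E; last first.
  rewrite -ge0_expectation_normal_affine//.
  by apply: eq_integral => y _; rewrite addr0.
apply: eq_integral => t _ /=.
transitivity (\int[lambda]_z ((g t * normal_pdf 0 c t)%:E *
    (normal_pdf (t * b / c ^+ 2) (a / c) z)%:E)%E)%E.
  apply: eq_integral => z _.
  by rewrite /h /k/= -mulrA (normal_pdf_convolution _ _ a0 c0 cab) mulrA EFinM.
rewrite ge0_integralZl//.
- by rewrite integral_normal_pdf mule1.
- by apply/measurable_EFinP; exact: measurable_normal_pdf.
- by move=> z _; rewrite lee_fin normal_pdf_ge0.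
- by rewrite lee_fin mulr_ge0// normal_pdf_ge0.
Qed.

Lemma normal_pdf_is_derive x : is_derive x (1 : R) phi (- x * phi x).
Proof.
rewrite (_ : phi = fun x => (1 * Num.sqrt (2 * pi))^-1 *
    expR (- (x - 0) ^+ 2 / (2 * 1 ^+ 2))); last first.
  by apply/funext => y; rewrite normal_pdf_gt0E.
apply: is_derive_eq.
have k0 := sqrt2pi_gt0; rewrite /GRing.scale/=.
by field; rewrite gt_eqF.
Qed.

Lemma cvg_mul_normal_pdf0 : n%:R * phi n%:R @[n --> \oo] --> (0 : R).
Proof.
have k0 := sqrt2pi_gt0.
apply: (@squeeze_cvgr _ _ _ _ (cst 0)
  (fun n => 2 * (Num.sqrt (2 * pi))^-1 * n%:R^-1)).
- near=> n; set x : R := n%:R.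
  have x0 : 0 < x by rewrite ltr0n; near: n; exact: nbhs_infty_gt.
  rewrite mulr_ge0 ?normal_pdf_ge0 ?(ltW x0)//=.
  rewrite normal_pdf_gt0E// mul1r subr0 expr1n mulr1 mulNr.
  set q := x ^+ 2 / 2.
  have q0 : 0 < q by rewrite divr_gt0// exprn_gt0.
  (* from q <= exp q *)
  have eq : expR (- q) <= q^-1.
    rewrite expRN lef_pV2 ?posrE ?expR_gt0//.
    by apply: le_trans (expR_ge1Dx q); rewrite lerDr.
  have -> : 2 / Num.sqrt (2 * pi) / x = x * ((Num.sqrt (2 * pi))^-1 * q^-1).
    by rewrite /q; field; rewrite !gt_eqF.
  by rewrite ler_wpM2l ?(ltW x0)// ler_wpM2l// invr_ge0 ltW.
- exact: cvg_cst.
- rewrite -[X in _ --> X](mulr0 (2 * (Num.sqrt (2 * pi))^-1)).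
  apply: cvgMl_tmp; rewrite -cvg_shiftS; exact: cvg_harmonic.
Unshelve. all: by end_near. Qed.

(** The derivative of [- phi] is [x * phi x]. *)
Lemma normal_integration_by_parts (n : R) : 0 < n ->
  (\int[lambda]_(x in `[0%R, n]) (x ^+ 2 * phi x)%:E + (n * phi n)%:E =
   \int[lambda]_(x in `[0%R, n]) (phi x)%:E)%E.
Proof.
move=> n0.
have cphi : continuous phi by apply: continuous_normal_pdf; exact: oner_neq0.
have dphi x : is_derive x (1 : R) (fun x => - phi x) (x * phi x).
  have dp := normal_pdf_is_derive x.
  by apply: is_derive_eq; rewrite mulNr opprK.
have cN : continuous (fun x => - phi x).
  by move=> x; apply: cvgN; exact: cphi.
have := @integration_by_parts R id (fun x => - phi x) (cst 1)
  (fun x => x * phi x) 0 n n0.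
move=> /(_ _ _ _ _ _ _)/wrap[].
- by apply: continuous_subspaceT => x; exact: cst_continuous.
- split.
  + by move=> x _; exact: derivable_id.
  + by apply: cvg_at_right_filter; exact: cvg_id.
  + by apply: cvg_at_left_filter; exact: cvg_id.
- by move=> x _; rewrite derive1E derive_id.
- by apply: continuous_subspaceT => x; apply: cvgM; [exact: cvg_id|exact: cphi].
- split.
  + by move=> x _; have [] := dphi x.
  + by apply: cvg_at_right_filter; exact: cN.
  + by apply: cvg_at_left_filter; exact: cN.
- by move=> x _; rewrite derive1E; have [_ ->] := dphi x.
rewrite mul0r subr0 => e.
have -> : (\int[lambda]_(x in `[0%R, n]) (x ^+ 2 * phi x)%:E =
    (- (n * phi n))%:E + \int[lambda]_(x in `[0%R, n]) (phi x)%:E)%E.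
  under eq_integral do rewrite expr2 -mulrA.
  rewrite e mulrN; congr (_ + _)%E.
  under eq_integral do rewrite mul1r EFinN.
  have iphi : lambda.-integrable `[0%R, n] (EFin \o phi).
    by apply: (integrableS measurableT) => //; exact: integrable_normal_pdf.
  by rewrite integralN/= ?oppeK//; exact: integrable_add_def.
by rewrite addeAC -EFinD addNr add0e.
Qed.

Lemma normal_half_second_moment :
  (\int[lambda]_(x in `[0%R, +oo[) (x ^+ 2 * phi x)%:E =
   \int[lambda]_(x in `[0%R, +oo[) (phi x)%:E)%E.
Proof.
have mphi : measurable_fun setT phi by exact: measurable_normal_pdf.
have c0 := ge0_cvgn_integral (mu := lambda) (normal_pdf_ge0 0 1) mphi.
have x2phi0 x : 0 <= x ^+ 2 * phi x.
  by rewrite mulr_ge0 ?sqr_ge0 ?normal_pdf_ge0.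
have mx2phi : measurable_fun setT (fun x => x ^+ 2 * phi x).
  by apply: measurable_funM => //; exact: measurable_funX.
have c2 := ge0_cvgn_integral (mu := lambda) x2phi0 mx2phi.
have cp : (n%:R * phi n%:R)%:E @[n --> \oo] --> (0%:E : \bar R).
  by apply: cvg_EFin; [exact: nearW|exact: cvg_mul_normal_pdf0].
have c2p : (\int[lambda]_(x in `[0%R, n%:R]) (x ^+ 2 * phi x)%:E
    + (n%:R * phi n%:R)%:E)%E @[n --> \oo] -->
    (\int[lambda]_(x in `[0%R, +oo[) (x ^+ 2 * phi x)%:E + 0%:E)%E.
  by apply: cvgeD c2 cp; rewrite fin_num_adde_defl.
rewrite adde0 in c2p; apply: (cvg_unique _ c2p) => //.
apply: cvg_trans c0; apply: near_eq_cvg; near=> n.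
apply/esym/normal_integration_by_parts; rewrite ltr0n.
by near: n; exact: nbhs_infty_gt.
Unshelve. all: by end_near. Qed.

Lemma normal_pdf_even x : phi x = phi (- x).
Proof. by rewrite !normal_pdf_gt0E// !subr0 sqrrN. Qed.

Lemma normal_second_moment :
  (\int[normal_prob (0 : R) 1]_x (x ^+ 2)%:E = 1)%E.
Proof.
have cphi : continuous phi by apply: continuous_normal_pdf; exact: oner_neq0.
rewrite ge0_integral_normal_prob; last 2 first.
  by apply/measurable_EFinP; exact: measurable_funX.
  by move=> x; rewrite lee_fin sqr_ge0.
transitivity (\int[lambda]_x (x ^+ 2 * phi x)%:E)%E.
  by apply: eq_integral => x _; rewrite EFinM.
rewrite ge0_symfun_integralT; last 3 first.
- by move=> x; rewrite mulr_ge0 ?sqr_ge0 ?normal_pdf_ge0.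
- by move=> x; apply: cvgM; [exact: exprn_continuous|exact: cphi].
- by move=> x /=; rewrite sqrrN -normal_pdf_even.
rewrite -set_itvcy normal_half_second_moment set_itvcy.
rewrite -ge0_symfun_integralT//; first exact: integral_normal_pdf.
- by move=> x; exact: normal_pdf_ge0.
- by move=> x; exact: normal_pdf_even.
Qed.

Lemma ge0_normal_opp (f : R -> R) :
  measurable_fun setT f -> (forall x, 0 <= f x) ->
  (\int[normal_prob (0 : R) 1]_x (f (- x))%:E =
   \int[normal_prob (0 : R) 1]_x (f x)%:E)%E.
Proof.
move=> mf f0.
have mfN : measurable_fun setT (fun x => f (- x)).
  by apply: measurableT_comp => //; exact: measurable_funN.
rewrite !ge0_integral_normal_prob//; try exact/measurable_EFinP;
  try by move=> x; rewrite lee_fin.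
pose h x := ((f x)%:E * (phi x)%:E)%E.
have -> : (\int[lambda]_x h x =
    \int[pushforward lambda (-%R : _ -> measurableTypeR R)]_x h x)%E.
  by apply: eq_measure_integral => A mA _; exact/esym/lebesgue_measureN.
rewrite (@ge0_integral_pushforward _ _ _ (measurableTypeR R) R
  (-%R : measurableTypeR R -> measurableTypeR R) _ lambda setT h).
- by apply: eq_integral => x _; rewrite /h/= -normal_pdf_even.
- exact: measurable_funN.
- exact: measurableT.
- apply: emeasurable_funM; apply/measurable_EFinP => //.
  exact: measurable_normal_pdf.
- by move=> x _; rewrite mule_ge0// lee_fin// normal_pdf_ge0.
Qed.

Lemma normal_mean : \int[normal_prob (0 : R) 1]_x x = 0 :> R.
Proof.
pose p (x : R) := Num.max x 0.
have p0 x : 0 <= p x by rewrite /p le_max lexx orbT.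
have mp : measurable_fun setT p by exact: measurable_maxr.
rewrite /Rintegral integralE.
have -> : (\int[normal_prob (0 : R) 1]_x ((fun x => x%:E)^\-) x =
    \int[normal_prob (0 : R) 1]_x (p (- x))%:E)%E.
  by apply: eq_integral => x _; rewrite funenegE /p EFin_max EFinN.
have -> : (\int[normal_prob (0 : R) 1]_x ((fun x => x%:E)^\+) x =
    \int[normal_prob (0 : R) 1]_x (p x)%:E)%E.
  by apply: eq_integral => x _; rewrite funeposE /p EFin_max.
rewrite (ge0_normal_opp mp p0).
by case: (\int[_]_x _)%E => //= r; rewrite subrr.
Qed.

End gaussian.

(** * Sums of independent variables *)

Section iterated_integrals.
Context d (T : measurableType d) d' (T' : measurableType d')
  d'' (T'' : measurableType d'') (R : realType).
Variables (P : probability T R) (P' : probability T' R)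
  (P'' : probability T'' R).

(** Reduces identities between iterated integrals of bounded functions to
    nonnegative functions, for which Tonelli's theorem has no integrability
    conditions. *)
Lemma iterated_Rintegral (H : T -> T' -> R) (K : T'' -> R) (C : R) :
  (forall t u, `|H t u| <= C) -> (forall s, `|K s| <= C) ->
  (forall t, measurable_fun setT (H t)) ->
  measurable_fun setT (fun t => \int[P']_u H t u) ->
  measurable_fun setT K ->
  (\int[P]_t \int[P']_u (H t u + C)%:E = \int[P'']_s (K s + C)%:E)%E ->
  \int[P]_t \int[P']_u H t u = \int[P'']_s K s.
Proof.
move=> HC KC mH mIH mK.
have icst d0 (T0 : measurableType d0) (Q : probability T0 R) :
    Q.-integrable setT (EFin \o cst C).
  exact: integrable_EFin_cst.
have shift d0 (T0 : measurableType d0) (Q : probability T0 R) (f : T0 -> R) :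
    measurable_fun setT f -> (forall t, `|f t| <= C) ->
    (\int[Q]_t (f t + C)%:E = (\int[Q]_t f t + C)%:E)%E.
  move=> mf fC; have iF := bounded_integrable Q mf fC.
  have iFC := integrable_EFinD iF (icst _ _ Q).
  rewrite -[in RHS](Rintegral_probability_cst Q C) -RintegralD//;
    last exact: icst.
  by rewrite /Rintegral fineK//; exact: integrable_fin_num iFC.
have IHC t : `|\int[P']_u H t u| <= C.
  have iH := bounded_integrable P' (mH t) (HC t).
  apply: le_trans (le_normr_Rintegral _ _) _ => //.
  rewrite -[leRHS](Rintegral_probability_cst P'); apply: le_Rintegral => //.
  - exact: integrable_norm.
  - exact: icst.
under eq_integral do rewrite shift//.
by rewrite !shift// => -[] /addIr.
Qed.

End iterated_integrals.

Section product_law.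
Context d (T : measurableType d) (R : realType) (P : probability T R).
Implicit Types (W V : {RV P >-> R}) (A B : set R).

(** Normalizing by [P E], the law of [(W, V)] under the conditional
    probability given [E] coincides with the product law on rectangles, hence
    everywhere. *)
Lemma joint_law_product W V (E : set T) : measurable E ->
  (forall A B, measurable A -> measurable B ->
    P (W @^-1` A `&` V @^-1` B `&` E) =
    P (W @^-1` A) * P (V @^-1` B) * P E)%E ->
  forall C : set (R * R), measurable C ->
  (P ((fun t => (W t, V t)) @^-1` C `&` E) =
   (distribution P W \x distribution P V) C * P E)%E.
Proof.
move=> mE ind C mC.
have mZ : measurable_fun setT (fun t => (W t, V t)).
  exact: measurable_fun_pair.
have PEfin : P E \is a fin_num by exact: fin_num_measure.
have [PE0|PE0] := eqVneq (P E) 0%E.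
  rewrite PE0 mule0; apply/eqP; rewrite -measure_le0 -PE0.
  apply: le_measure; rewrite ?inE//; apply: measurableI => //.
  by rewrite -[X in measurable X]setTI; exact: mZ.
have r0 : 0 < fine (P E).
  by rewrite fine_gt0// lt0e PE0 measure_ge0/= ltey_eq PEfin.
have c0 : 0 <= (fine (P E))^-1 by rewrite invr_ge0 ltW.
pose m' := mscale (NngNum c0)
  (measure_function_pushforward__canonical__measure_function_Measure
     (mrestr P mE) mZ).
have cK : ((fine (P E))^-1%:E * P E = 1)%E.
  by rewrite -[X in (_ * X)%E](fineK PEfin) -EFinM mulVf ?gt_eqF.
rewrite (@product_measure_unique _ _ _ _ _ _ _ m')//.
  rewrite /m' /= /mscale/= /pushforward /mrestr muleAC cK mul1e.
  by [].
move=> A B mA mB; rewrite /m' /= /mscale/= /pushforward /mrestr.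
rewrite [X in (_ * P X)%E](_ : _ = W @^-1` A `&` V @^-1` B `&` E)//.
by rewrite ind// muleC -muleA (muleC (P E)) cK mule1.
Qed.

Lemma expectation_sum_indep W V (h : R -> R) (C : R) :
  (forall A B, measurable A -> measurable B ->
    P (W @^-1` A `&` V @^-1` B) = P (W @^-1` A) * P (V @^-1` B))%E ->
  measurable_fun setT h -> (forall x, `|h x| <= C) ->
  \int[P]_t h (W t + V t) = \int[P]_t \int[P]_u h (W t + V u).
Proof.
move=> ind mh hC.
have mV : measurable_fun setT V by exact: measurable_funPT.
have mW : measurable_fun setT W by exact: measurable_funPT.
have mIV := measurable_average P mV mh hC.
apply/esym/iterated_Rintegral => //.
- by move=> t; exact: measurable_translate.
- exact: (measurableT_comp mIV).
- by apply: measurableT_comp => //; exact: measurable_funD.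
pose k (z : R * R) := (h (z.1 + z.2) + C)%:E.
have mk : measurable_fun setT k.
  apply/measurable_EFinP; apply: measurable_funD => //.
  by apply: measurableT_comp => //; exact: measurable_funD.
have k0 z : (0 <= k z)%E.
  by rewrite lee_fin; have := hC (z.1 + z.2); rewrite ler_norml; lra.
transitivity (\int[distribution P W \x distribution P V]_z k z)%E.
  rewrite fubini_tonelli1// ge0_integral_distribution//.
  - apply: eq_integral => t _ /=.
    rewrite /fubini_F ge0_integral_distribution//.
    exact: measurableT_comp.
  - exact: measurable_fun_fubini_tonelli_F.
  - by move=> x; exact: integral_ge0.
have mZ : measurable_fun setT (fun t => (W t, V t)).
  exact: measurable_fun_pair.
have joint (A : set (R * R)) : measurable A ->
    ((distribution P W \x distribution P V) A =
    pushforward P (fun t => (W t, V t)) A)%E.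
  move=> mA; rewrite -[LHS]mule1 -(probability_setT P) -joint_law_product//.
    by rewrite setIT.
  by move=> B D mB mD; rewrite setIT probability_setT mule1 ind.
transitivity (\int[pushforward P (fun t => (W t, V t))]_z k z)%E.
  by apply: eq_measure_integral => A mA _; exact: joint.
by rewrite ge0_integral_pushforward.
Qed.

End product_law.

Section independent_sums.
Context d (T : measurableType d) (R : realType) (P : probability T R).
Variable X : nat -> {RV P >-> R}.

Definition partial_sum (k : nat) : {RV P >-> R} :=
  \sum_(j < k) (X j : {mfun T >-> R}).

Lemma partial_sumE k t : partial_sum k t = \sum_(j < k) X j t.
Proof. by rewrite /partial_sum mfun_sum. Qed.

Lemma partial_sumS k t : partial_sum k.+1 t = partial_sum k t + X k t.
Proof. by rewrite !partial_sumE big_ord_recr. Qed.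

Hypothesis X_indep : mutually_independent X.

Lemma measurable_bigcap_preimage (J : {fset nat}) (B : nat -> set R) :
  (forall i, i \in J -> measurable (B i)) ->
  measurable (\bigcap_(i in [set` J]) X i @^-1` B i).
Proof.
move=> mB; apply: bigcap_measurableType => i /= iJ.
by apply: measurable_funPTI; exact: mB.
Qed.

(** Independence of a sum from the later variables, by induction on the number
    of terms: the joint law of the sum so far and the next term, on an event of
    later variables, is a multiple of the product law by [joint_law_product].
    The family of later events has to be kept arbitrary for the next term to
    be absorbed in it. *)
Lemma partial_sum_indep k (A : set R) (J : {fset nat}) (B : nat -> set R) :
  measurable A -> (forall i, i \in J -> (k <= i)%N) ->
  (forall i, i \in J -> measurable (B i)) ->
  (P (partial_sum k @^-1` A `&` \bigcap_(i in [set` J]) X i @^-1` B i) =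
   P (partial_sum k @^-1` A) * \prod_(i <- J) P (X i @^-1` B i))%E.
Proof.
elim: k A J B => [|k IH] A J B mA kJ mB.
  rewrite -X_indep//.
  have [A0|A0] := pselect (A 0).
    rewrite (_ : partial_sum 0 @^-1` A = setT).
      by rewrite setTI probability_setT mul1e.
    by apply/seteqP; split => // t _; rewrite /= partial_sumE big_ord0.
  rewrite (_ : partial_sum 0 @^-1` A = set0) ?set0I ?measure0 ?mul0e//.
  by apply/seteqP; split => // t; rewrite /= partial_sumE big_ord0.
have kJ' : k \notin J by apply/negP => /kJ; rewrite ltnn.
set E := \bigcap_(i in _) _.
have mE : measurable E by exact: measurable_bigcap_preimage.
have PE : (P E = \prod_(i <- J) P (X i @^-1` B i))%E by exact: X_indep.
have ind A1 B1 : measurable A1 -> measurable B1 ->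
    (P (partial_sum k @^-1` A1 `&` X k @^-1` B1 `&` E) =
     P (partial_sum k @^-1` A1) * P (X k @^-1` B1) * P E)%E.
  move=> mA1 mB1; pose B' i := if i == k then B1 else B i.
  have B'E i : i \in J -> B' i = B i.
    by rewrite /B'; case: eqP => // -> kJ1; rewrite kJ1 in kJ'.
  have B'k : B' k = B1 by rewrite /B' eqxx.
  have := IH A1 (k |` J)%fset B' mA1.
  rewrite big_fsetU1//= B'k (eq_big_seq (fun i => P (X i @^-1` B i)));
    last first.
    by move=> i iJ; rewrite B'E.
  rewrite -PE muleA => <-.
  - congr (P _); rewrite -setIA; congr (_ `&` _); apply/seteqP; split => t /=.
      move=> [Xk EJ] i /=; rewrite !inE => /orP[/eqP ->|iJ].
        by rewrite B'k.
      by rewrite B'E//; exact: EJ.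
    move=> EJ; split.
      by have := EJ k; rewrite B'k; apply; rewrite /= !inE eqxx.
    move=> i /= iJ; rewrite -(B'E _ iJ); apply: EJ.
    by rewrite /= !inE iJ orbT.
  - by move=> i; rewrite !inE => /orP[/eqP->//|/kJ/ltnW].
  - by move=> i; rewrite !inE /B'; case: eqP => // _ /= iJ; exact: mB.
have indT A1 B1 : measurable A1 -> measurable B1 ->
    (P (partial_sum k @^-1` A1 `&` X k @^-1` B1 `&` setT) =
     P (partial_sum k @^-1` A1) * P (X k @^-1` B1) * P setT)%E.
  move=> mA1 mB1; have := IH A1 [fset k]%fset (fun=> B1) mA1.
  rewrite set_fset1 bigcap_set1 big_seq_fset1 setIT probability_setT mule1.
  by apply => // i; rewrite inE => /eqP ->.
pose C : set (R * R) := [set z | A (z.1 + z.2)].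
have mC : measurable C.
  rewrite -[X in measurable X]setTI.
  by apply: (@measurable_funD _ _ _ _ fst snd) => //; exact: measurableT.
have SE : partial_sum k.+1 @^-1` A =
    (fun t => (partial_sum k t, X k t)) @^-1` C.
  by apply/seteqP; split => t /=; rewrite partial_sumS.
rewrite -PE SE (joint_law_product mE ind mC); congr (_ * _)%E.
have := joint_law_product measurableT indT mC.
by rewrite setIT probability_setT mule1 => ->.
Qed.

Lemma partial_sum_indep_next k (A B : set R) : measurable A -> measurable B ->
  (P (partial_sum k @^-1` A `&` X k @^-1` B) =
   P (partial_sum k @^-1` A) * P (X k @^-1` B))%E.
Proof.
move=> mA mB; have := @partial_sum_indep k A [fset k]%fset (fun=> B) mA.
rewrite set_fset1 bigcap_set1 big_seq_fset1.
by apply => // i; rewrite inE => /eqP ->.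
Qed.

End independent_sums.

(** * Replacing the terms of an independent sum by normal ones *)

Section replacement.
Context {R : realType}.
Local Notation gamma := (normal_prob (0 : R) 1).

Lemma normal_sqr_integrable :
  gamma.-integrable setT (EFin \o (fun z : R => z ^+ 2)).
Proof.
apply/integrableP; split.
  by apply/measurable_EFinP; exact: measurable_funX.
under eq_integral do rewrite /= ger0_norm ?sqr_ge0//.
by rewrite normal_second_moment ltry.
Qed.

Lemma normal_scaled_sqr_integrable (a : R) :
  gamma.-integrable setT (EFin \o (fun z => (a * z) ^+ 2)).
Proof.
rewrite (_ : (fun z => _) = (fun z => a ^+ 2 * z ^+ 2)).
  exact: integrable_EFinZ normal_sqr_integrable.
by apply/funext => z; rewrite exprMn.
Qed.

Lemma normal_scaled_mean (a : R) : \int[gamma]_z (a * z) = 0.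
Proof.
have i1 := sqr_integrable_integrable (P := gamma) (@measurable_id _ _ setT)
  normal_sqr_integrable.
by rewrite RintegralZl// normal_mean mulr0.
Qed.

Lemma normal_scaled_variance (a : R) : \int[gamma]_z (a * z) ^+ 2 = a ^+ 2.
Proof.
under eq_Rintegral do rewrite exprMn.
rewrite RintegralZl//; last exact: normal_sqr_integrable.
by rewrite /Rintegral normal_second_moment mulr1.
Qed.

Lemma normal_convolution (a b c C : R) (g : R -> R) : 0 < a -> 0 < c ->
  c ^+ 2 = a ^+ 2 + b ^+ 2 -> continuous g -> (forall x, `|g x| <= C) ->
  \int[gamma]_z \int[gamma]_y g (b * z + a * y) = \int[gamma]_y g (c * y).
Proof.
move=> a0 c0 cab cg gC.
have mg : measurable_fun setT g by exact: continuous_measurable_fun.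
have mZ (k : R) : measurable_fun setT (fun z : measurableTypeR R => k * z).
  exact: measurable_funM.
apply: iterated_Rintegral => //.
- move=> z; exact: measurable_translate.
- apply: (measurableT_comp (measurable_average gamma (mZ a) mg gC)).
  exact: mZ.
- exact: measurableT_comp.
rewrite -[RHS](@ge0_normal_convolution _ a b c (fun x => g x + C))//.
- apply: eq_integral => z _; apply: eq_integral => y _.
  by rewrite (addrC (b * z)).
- by move=> x; apply: cvgD; [exact: cg|exact: cvg_cst].
- by move=> x; have := gC x; rewrite ler_norml; lra.
Qed.

Context d (T : measurableType d) (P : probability T R).

Lemma lindeberg_step (Y : T -> R) (v C x : R) g g1 g2 :
  measurable_fun setT Y ->
  P.-integrable setT (EFin \o (fun t => Y t ^+ 2)) -> 0 <= v ->
  \int[P]_t Y t = 0 -> \int[P]_t Y t ^+ 2 = v ->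
  taylor_bounded C g g1 g2 ->
  `|\int[P]_t g (x + Y t) - \int[gamma]_z g (x + Num.sqrt v * z)| <=
  4 * C * (\int[P]_t lindeberg_fun (Y t) +
           \int[gamma]_z lindeberg_fun (Num.sqrt v * z)).
Proof.
move=> mY iY2 v0 EY EY2 tg; set a := Num.sqrt v.
have mZ : measurable_fun setT (fun z : measurableTypeR R => a * z).
  exact: measurable_funM.
have := translate_expectation mY iY2 tg x EY EY2.
have := translate_expectation mZ (normal_scaled_sqr_integrable a) tg x
  (normal_scaled_mean a) (normal_scaled_variance a).
rewrite sqr_sqrtr// !ler_norml => /andP[z0 z1] /andP[y0 y1].
by apply/andP; split; lra.
Qed.

Variables (X : nat -> {RV P >-> R}) (v : nat -> R).
Hypothesis X_indep : mutually_independent X.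
Hypothesis X_sqr : forall k, P.-integrable setT (EFin \o (fun t => X k t ^+ 2)).
Hypothesis X_mean : forall k, \int[P]_t X k t = 0.
Hypothesis X_var : forall k, \int[P]_t X k t ^+ 2 = v k.
Hypothesis v_gt0 : forall k, 0 < v k.

(** In the induction, the last term is replaced first: conditionally on the
    others, it averages [g] over translates.  The result is again an average
    over the remaining terms of a function with the same Taylor bounds, to
    which the induction hypothesis applies. *)
Lemma lindeberg_replacement n C g g1 g2 : taylor_bounded C g g1 g2 ->
  `|\int[P]_t g (partial_sum X n t) -
    \int[gamma]_z g (Num.sqrt (\sum_(k < n) v k) * z)| <=
  4 * C * \sum_(k < n) (\int[P]_t lindeberg_fun (X k t) +
           \int[gamma]_z lindeberg_fun (Num.sqrt (v k) * z)).
Proof.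
elim: n g g1 g2 => [|n IH] g g1 g2 tg.
  rewrite !big_ord0 mulr0 sqrtr0.
  under eq_Rintegral do rewrite partial_sumE big_ord0.
  under [X in _ - X]eq_Rintegral do rewrite mul0r.
  by rewrite !Rintegral_probability_cst subrr normr0.
have mg := taylor_bounded_measurable tg; have [_ _ gC _] := tg.
have g0C x : `|g x| <= C by have [] := gC x.
set V := fun n => \sum_(k < n) v k.
have V0 k : 0 <= V k by apply: sumr_ge0 => i _; exact: ltW.
have VS : V n.+1 = V n + v n by rewrite /V big_ord_recr.
set a := Num.sqrt (v n).
have mZ : measurable_fun setT (fun z : measurableTypeR R => a * z).
  exact: measurable_funM.
have mX k : measurable_fun setT (X k) by exact: measurable_funPT.
have mS : measurable_fun setT (partial_sum X n) by exact: measurable_funPT.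
have tB := taylor_bounded_average gamma mZ tg.
have := IH _ _ _ tB.
rewrite -[(\sum_(k < n) v k)]/(V n).
rewrite (@normal_convolution _ _ (Num.sqrt (V n.+1)) C)//; first last.
- exact: taylor_bounded_continuous tg.
- by rewrite !sqr_sqrtr// ?VS 1?addrC// ltW.
- by rewrite sqrtr_gt0 VS ltr_wpDl.
- by rewrite sqrtr_gt0.
move=> IHn.
have : `|\int[P]_t g (partial_sum X n.+1 t) -
    \int[P]_t \int[gamma]_z g (partial_sum X n t + a * z)| <=
  4 * C * (\int[P]_t lindeberg_fun (X n t) +
           \int[gamma]_z lindeberg_fun (Num.sqrt (v n) * z)).
  under eq_Rintegral do rewrite partial_sumS.
  rewrite (expectation_sum_indep (partial_sum_indep_next X_indep n) mg g0C).
  have bA x : `|\int[P]_u g (x + X n u)| <= C by exact: le_average.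
  have bB x : `|\int[gamma]_z g (x + a * z)| <= C by exact: le_average.
  have mA := measurableT_comp (measurable_average P (mX n) mg g0C) mS.
  have mB := measurableT_comp (measurable_average gamma mZ mg g0C) mS.
  have iA := bounded_integrable P mA (fun t => bA (partial_sum X n t)).
  have iB := bounded_integrable P mB (fun t => bB (partial_sum X n t)).
  rewrite -RintegralB//; apply: le_trans (le_normr_Rintegral _ _) _ => //.
    exact: integrable_EFinB.
  rewrite -[leRHS](Rintegral_probability_cst P); apply: le_Rintegral => //.
  - by apply: integrable_norm; exact: integrable_EFinB.
  - exact: integrable_EFin_cst.
  - move=> t _; apply: lindeberg_step => //; first exact: ltW.
    exact: tg.
rewrite [X in _ -> _ <= 4 * C * X]big_ord_recr/= mulrDr.
rewrite -[\sum_(k < n.+1) v k]/(V n.+1).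
move: IHn; rewrite !ler_norml => /andP[i0 i1] /andP[s0 s1].
by apply/andP; split; lra.
Qed.

End replacement.

(** * The Lindeberg functional *)

Section lindeberg_tail.
Context {R : realType}.

Lemma lindeberg_fun_scale (c a x : R) : 0 <= c <= a ->
  lindeberg_fun (c * x) <= c ^+ 2 * (x ^+ 2 * Num.min 1 (a * `|x|)).
Proof.
move=> /andP[c0 ca]; rewrite /lindeberg_fun exprMn -mulrA.
rewrite ler_wpM2l ?sqr_ge0// ler_wpM2l ?sqr_ge0//.
by rewrite normrM (ger0_norm c0) le_min2// ler_wpM2r.
Qed.

Context d (T : measurableType d) (Q : probability T R).
Variable U : T -> R.
Hypothesis mU : measurable_fun setT U.
Hypothesis iU : Q.-integrable setT (EFin \o (fun t => U t ^+ 2)).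

(** Rescaled Lindeberg functional of [U]: if [c <= a], the remainder of
    [c * U] is at most [c ^+ 2] times it. *)
Definition tail_moment (a : R) := \int[Q]_t (U t ^+ 2 * Num.min 1 (a * `|U t|)).

Lemma measurable_tail_moment a :
  measurable_fun setT (fun t => U t ^+ 2 * Num.min 1 (a * `|U t|)).
Proof.
apply: measurable_funM; first exact: measurable_funX.
apply: measurable_minr => //; apply: measurable_funM => //.
exact: measurableT_comp.
Qed.

Lemma tail_moment_bounds (a x : R) : 0 <= a ->
  0 <= x ^+ 2 * Num.min 1 (a * `|x|) <= x ^+ 2.
Proof.
move=> a0; rewrite mulr_ge0 ?sqr_ge0//= ?ler_piMr ?sqr_ge0 ?ge_min ?lexx//.
by rewrite le_min ler01/= mulr_ge0.
Qed.

Lemma tail_moment_integrable (a : R) : 0 <= a ->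
  Q.-integrable setT (EFin \o (fun t => U t ^+ 2 * Num.min 1 (a * `|U t|))).
Proof.
move=> a0; apply: (le_integrable measurableT _ _ iU).
  by apply/measurable_EFinP; exact: measurable_tail_moment.
move=> t _ /=; rewrite lee_fin; have /andP[? ?] := tail_moment_bounds (U t) a0.
by rewrite [leRHS]ger0_norm ?sqr_ge0// ger0_norm.
Qed.

Lemma lindeberg_scale_integrable (c : R) :
  Q.-integrable setT (EFin \o (fun t => lindeberg_fun (c * U t))).
Proof.
apply: lindeberg_fun_integrable; first exact: measurable_funM.
rewrite (_ : (fun t => _) = (fun t => c ^+ 2 * U t ^+ 2)).
  exact: integrable_EFinZ.
by apply/funext => t; rewrite exprMn.
Qed.

Lemma lindeberg_scale_le (c a : R) : 0 <= c <= a ->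
  \int[Q]_t lindeberg_fun (c * U t) <= c ^+ 2 * tail_moment a.
Proof.
move=> ca; have a0 : 0 <= a by move: ca => /andP[]; exact: le_trans.
have itail := tail_moment_integrable a0.
rewrite /tail_moment -RintegralZl//; apply: le_Rintegral => //.
- exact: lindeberg_scale_integrable.
- exact: integrable_EFinZ.
- by move=> t _; exact: lindeberg_fun_scale.
Qed.

Lemma cvg_tail_moment (a : nat -> R) : (forall n, 0 <= a n) ->
  a n @[n --> \oo] --> (0 : R) -> tail_moment (a n) @[n --> \oo] --> (0 : R).
Proof.
move=> a0 a_cvg.
have [|||||_ _ +] := @dominated_convergence _ _ _ Q setT measurableT
  (fun n t => (U t ^+ 2 * Num.min 1 (a n * `|U t|))%:E) (cst 0%E)
  (fun t => (U t ^+ 2)%:E).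
- by move=> n; apply/measurable_EFinP; exact: measurable_tail_moment.
- exact: measurable_cst.
- apply/aeW => t _; apply: cvg_EFin; first exact: nearW.
  have lim0 : U t ^+ 2 * (a n * `|U t|) @[n --> \oo] --> (0 : R).
    rewrite -[X in _ --> X](mulr0 (U t ^+ 2)) -[X in _ * X](mul0r `|U t|).
    by apply: cvgMl_tmp; exact: cvgMr_tmp.
  apply: (@squeeze_cvgr _ _ _ _ (cst 0)
    (fun n => U t ^+ 2 * (a n * `|U t|))) => //.
    near=> n; have /andP[-> _] := tail_moment_bounds (U t) (a0 n).
    by rewrite /= ler_wpM2l ?sqr_ge0// ge_min lexx orbT.
  exact: cvg_cst.
- exact: iU.
- apply/aeW => t n _; rewrite lee_fin.
  by have /andP[? ?] := tail_moment_bounds (U t) (a0 n); rewrite ger0_norm.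
by rewrite integral0 => /fine_cvg.
Unshelve. all: by end_near. Qed.

End lindeberg_tail.

(** * Location-scale mixtures *)

Section mixture.
Context {R : realType}.

(** Half-open intervals are stable under intersection, generate the Borel sets
    and have their measure read off the distribution function. *)
Lemma finite_measure_cdf_unique (m1 m2 : {measure set R -> \bar R}) :
  (m1 setT < +oo)%E ->
  (forall x, m1 `]-oo, x]%classic = m2 `]-oo, x]%classic) ->
  forall A, measurable A -> m1 A = m2 A.
Proof.
move=> m1oo m12.
have fin1 A : measurable A -> (m1 A < +oo)%E.
  by move=> mA; apply: le_lt_trans m1oo; apply: le_measure; rewrite ?inE.
have ocE (m : {measure set R -> \bar R}) (a b : R) : a <= b ->
    (m `]-oo, b]%classic < +oo)%E ->
    m `]a, b]%classic = (m `]-oo, b]%classic - m `]-oo, a]%classic)%E.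
  move=> ab moo; have -> : `]a, b]%classic = `]-oo, b] `\` `]-oo, a].
    by rewrite -[RHS]setCK setCD setCitvl setUC -[LHS]setCK setCitv.
  by rewrite measureD ?setIidr//; exact: subset_itvl.
apply: (measure_unique (@ocitv R) (fun n => `](- n%:R), n%:R]%classic)) => //.
- exact: ocitvI.
- by move=> n; exact: is_ocitv.
- by rewrite -(bigcup_itvT false false).
- move=> _ [[a b] _ <-] /=; have [ab|ba] := leP a b.
    by rewrite !ocE// -?m12 ?fin1.
  by rewrite set_itv_ge ?measure0// bnd_simp -leNgt ltW.
- by move=> n; exact: fin1.
Qed.

Context d (T : measurableType d) (P : probability T R).
Context d0 (T0 : measurableType d0) (Q : probability T0 R).
Variables (U : {RV Q >-> R}) (X : {RV P >-> R}) (p s mu : R).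
Hypothesis p01 : 0 <= p <= 1.
Hypothesis s0 : 0 < s.
Hypothesis X_cdf : forall x,
  (cdf X x = (1 - p)%:E * cdf U (x - mu) + p%:E * cdf U ((x - mu) / s))%E.

Lemma ge0_mixture_integral (h : R -> R) : measurable_fun setT h ->
  (forall x, 0 <= h x) ->
  (\int[P]_t (h (X t))%:E = (1 - p)%:E * \int[Q]_u (h (U u + mu)%R)%:E +
     p%:E * \int[Q]_u (h (s * U u + mu)%R)%:E)%E.
Proof.
move=> mh h0; have /andP[p0 p1] := p01.
have q0 : 0 <= 1 - p by rewrite subr_ge0.
have mU : measurable_fun setT U by exact: measurable_funPT.
have m1 : measurable_fun setT (fun u => U u + mu) by exact: measurable_funD.
have m2 : measurable_fun setT (fun u => s * U u + mu).
  by apply: measurable_funD => //; exact: measurable_funM.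
pose Q1 :=
  measure_function_pushforward__canonical__measure_function_Measure Q m1.
pose Q2 :=
  measure_function_pushforward__canonical__measure_function_Measure Q m2.
pose M := measure_add (mscale (NngNum q0) Q1) (mscale (NngNum p0) Q2).
have ME A : (M A = (1 - p)%:E * Q1 A + p%:E * Q2 A)%E.
  by rewrite /M measure_addE.
have XM A : measurable A -> distribution P X A = M A.
  move=> mA; apply: finite_measure_cdf_unique => //.
    by rewrite (le_lt_trans (probability_le1 _ _)) ?ltry.
  move=> x; rewrite -[LHS]/(cdf X x) X_cdf -[RHS]/(M _) ME/= /pushforward.
  rewrite /cdf /distribution /pushforward.
  congr (_ * Q _ + _ * Q _)%E; apply/seteqP; split=> u /=; rewrite !in_itv/=.
  - by rewrite lerBrDr.
  - by rewrite lerBrDr.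
  - by rewrite ler_pdivlMr// mulrC lerBrDr.
  - by rewrite ler_pdivlMr// mulrC lerBrDr.
have mhE : measurable_fun setT (EFin \o h) by exact/measurable_EFinP.
have hE x : (0 <= (EFin \o h) x)%E by rewrite lee_fin.
transitivity (\int[distribution P X]_y (h y)%:E)%E.
  by rewrite ge0_integral_distribution.
rewrite (eq_measure_integral M); last by move=> A mA _; exact: XM.
rewrite /M ge0_integral_measure_add//; last by move=> x _; exact: hE.
rewrite !ge0_integral_mscale//; try by move=> x _; exact: hE.
by rewrite !ge0_integral_pushforward// => x _; exact: hE.
Qed.

Lemma mixture_integral (h : R -> R) : measurable_fun setT h ->
  (forall x, 0 <= h x) ->
  Q.-integrable setT (EFin \o (fun u => h (U u + mu))) ->
  Q.-integrable setT (EFin \o (fun u => h (s * U u + mu))) ->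
  P.-integrable setT (EFin \o (fun t => h (X t))) /\
  \int[P]_t h (X t) = (1 - p) * \int[Q]_u h (U u + mu) +
     p * \int[Q]_u h (s * U u + mu).
Proof.
move=> mh h0 i1 i2; have E := ge0_mixture_integral mh h0.
have f1 := integrable_fin_num measurableT i1.
have f2 := integrable_fin_num measurableT i2.
split.
  apply/integrableP; split.
    by apply/measurable_EFinP; exact: measurableT_comp.
  under eq_integral do rewrite /= ger0_norm//.
  by rewrite E ltey_eq fin_numD !fin_numM.
rewrite {1}/Rintegral E /Rintegral -[X in (_ * X + _)%E](fineK f1).
by rewrite -[X in (_ + _ * X)%E](fineK f2).
Qed.

End mixture.

Section standardized_mixture.
Context {R : realType} d (T : measurableType d) (P : probability T R).
Context d0 (T0 : measurableType d0) (Q : probability T0 R).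
Variables (U : {RV Q >-> R}) (X : {RV P >-> R}) (p sigma mu s : R).
Hypothesis p01 : 0 <= p <= 1.
Hypothesis sigma1 : 1 <= sigma.
Hypothesis s0 : 0 < s.
Hypothesis X_cdf : forall x, (cdf X x =
  (1 - p)%:E * cdf U (x - mu) + p%:E * cdf U ((x - mu) / sigma))%E.
Hypothesis iU2 : Q.-integrable setT (EFin \o (fun u => U u ^+ 2)).
Hypothesis EU : \int[Q]_u U u = 0.
Hypothesis EU2 : \int[Q]_u U u ^+ 2 = 1.

Local Notation tau2 := ((1 - p) + p * sigma ^+ 2).
Local Notation Y t := ((X t - mu) / s).

Let sigma0 : 0 < sigma. Proof. exact: lt_le_trans sigma1. Qed.

Let mU : measurable_fun setT U. Proof. exact: measurable_funPT. Qed.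

Lemma affine_sqr_moment (a b : R) :
  Q.-integrable setT (EFin \o (fun u => (a * U u + b) ^+ 2)) /\
  \int[Q]_u (a * U u + b) ^+ 2 = a ^+ 2 + b ^+ 2.
Proof.
have iU := sqr_integrable_integrable mU iU2.
have i2 := integrable_EFinZ (a ^+ 2) iU2.
have i1 := integrable_EFinZ (2 * a * b) iU.
have i0 := integrable_EFin_cst Q (b ^+ 2).
have i12 := integrable_EFinD i2 i1.
rewrite (_ : (fun u => (a * U u + b) ^+ 2) =
  (fun u => a ^+ 2 * U u ^+ 2 + 2 * a * b * U u + b ^+ 2)); last first.
  by apply/funext => u; ring.
split; first exact: integrable_EFinD.
have m2 : \int[Q]_u (a ^+ 2 * U u ^+ 2) = a ^+ 2.
  by rewrite RintegralZl// EU2 mulr1.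
have m1 : \int[Q]_u (2 * a * b * U u) = 0 by rewrite RintegralZl// EU mulr0.
by rewrite RintegralD// RintegralD// m1 m2 (Rintegral_probability_cst Q) addr0.
Qed.

(** The shift [b] is there to recover the mean from second moments. *)
Lemma standardized_sqr_moment b :
  P.-integrable setT (EFin \o (fun t => (Y t + b) ^+ 2)) /\
  \int[P]_t (Y t + b) ^+ 2 = tau2 / s ^+ 2 + b ^+ 2.
Proof.
have hE1 u : ((U u + mu - mu) / s + b) ^+ 2 = (s^-1 * U u + b) ^+ 2.
  by rewrite addrK mulrC.
have hE2 u : ((sigma * U u + mu - mu) / s + b) ^+ 2 =
    ((sigma / s) * U u + b) ^+ 2.
  by rewrite addrK mulrAC.
have [i1 m1] := affine_sqr_moment s^-1 b.
have [i2 m2] := affine_sqr_moment (sigma / s) b.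
have [| | | |iP ->] := @mixture_integral _ _ _ _ _ _ _ U X p sigma mu p01
  sigma0 X_cdf
  (fun x => ((x - mu) / s + b) ^+ 2).
- apply: measurable_funX; apply: measurable_funD => //.
  by apply: measurable_funM => //; exact: measurable_funB.
- by move=> x; exact: sqr_ge0.
- rewrite (_ : (fun u => _) = (fun u => (s^-1 * U u + b) ^+ 2))//.
  exact/funext.
- rewrite (_ : (fun u => _) = (fun u => ((sigma / s) * U u + b) ^+ 2))//.
  exact/funext.
split => //.
under eq_Rintegral do rewrite hE1.
under [X in _ + _ * X]eq_Rintegral do rewrite hE2.
rewrite m1 m2 exprMn !exprVn; ring.
Qed.

Lemma standardized_variance :
  P.-integrable setT (EFin \o (fun t => Y t ^+ 2)) /\
  \int[P]_t Y t ^+ 2 = tau2 / s ^+ 2.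
Proof.
have := standardized_sqr_moment 0.
rewrite expr0n/= addr0.
by rewrite (_ : (fun t => (Y t + 0) ^+ 2) = (fun t => Y t ^+ 2))//;
  apply/funext => t; rewrite addr0.
Qed.

Lemma measurable_standardized : measurable_fun setT (fun t => Y t).
Proof.
by apply: measurable_funM => //; exact: measurable_funB.
Qed.

(** By polarization, 2 Y = (Y + 1)^2 - Y^2 - 1, which reduces the mean to
    integrals of nonnegative functions, where [mixture_integral] applies. *)
Lemma standardized_mean0 : \int[P]_t Y t = 0.
Proof.
have [i0 m0] := standardized_variance.
have [i1 m1] := standardized_sqr_moment 1.
have iY := sqr_integrable_integrable measurable_standardized i0.
have i2 := integrable_EFinZ 2 iY.
have i3 := integrable_EFin_cst P 1.
have i02 := integrable_EFinD i0 i2.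
have : \int[P]_t (Y t + 1) ^+ 2 =
    \int[P]_t (Y t ^+ 2) + 2 * \int[P]_t Y t + 1.
  rewrite -[X in _ + X](Rintegral_probability_cst P) -RintegralZl//.
  rewrite -!RintegralD//; apply: eq_Rintegral => t _; ring.
by rewrite m1 m0; lra.
Qed.

Lemma standardized_lindeberg a : sigma / s <= a ->
  \int[P]_t lindeberg_fun (Y t) <= tau2 / s ^+ 2 * tail_moment Q U a.
Proof.
move=> sa.
have sV0 : 0 < s^-1 by rewrite invr_gt0.
have ss : s^-1 <= sigma / s by rewrite ler_peMl// ltW.
have s1a : 0 <= s^-1 <= a by rewrite ltW//= (le_trans ss).
have s2a : 0 <= sigma / s <= a by rewrite sa divr_ge0// ltW.
have hE1 u : lindeberg_fun ((U u + mu - mu) / s) = lindeberg_fun (s^-1 * U u).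
  by rewrite addrK mulrC.
have hE2 u : lindeberg_fun ((sigma * U u + mu - mu) / s) =
    lindeberg_fun ((sigma / s) * U u).
  by rewrite addrK mulrAC.
have [| | | |_ ->] := @mixture_integral _ _ _ _ _ _ _ U X p sigma mu p01
  sigma0 X_cdf
  (fun x => lindeberg_fun ((x - mu) / s)).
- apply: (measurableT_comp (@measurable_lindeberg_fun R)).
  by apply: measurable_funM => //; exact: measurable_funB.
- by move=> x; exact: lindeberg_fun_ge0.
- rewrite (_ : (fun u => _) = (fun u => lindeberg_fun (s^-1 * U u))).
    exact: lindeberg_scale_integrable.
  exact/funext.
- rewrite (_ : (fun u => _) = (fun u => lindeberg_fun ((sigma / s) * U u))).
    exact: lindeberg_scale_integrable.
  exact/funext.
under eq_Rintegral do rewrite hE1.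
under [X in _ + _ * X]eq_Rintegral do rewrite hE2.
have /andP[p0 p1] := p01; have q0 : 0 <= 1 - p by rewrite subr_ge0.
have := ler_wpM2l q0 (lindeberg_scale_le mU iU2 s1a).
have := ler_wpM2l p0 (lindeberg_scale_le mU iU2 s2a).
by rewrite exprMn !exprVn; lra.
Qed.

End standardized_mixture.

(** * The central limit theorem *)

Section identity_variable.
Context {R : realType}.

(** [lebesgue_stieltjes_measure] and [normal_prob] live on [measurableTypeR R],
    which has the Borel sets of [R] but another display; the identity seen as
    a random variable carries them over to [R]. *)
Definition borel_id : measurableTypeR R -> R := idfun.

HB.instance Definition _ :=
  @isMeasurableFun.Build _ _ _ _ borel_id (@measurable_id _ _ setT).

Lemma measurable_borel_id : measurable_fun setT borel_id.
Proof. exact: measurable_id. Qed.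

Lemma borel_id_normal_sqr_integrable :
  (normal_prob (0 : R) 1).-integrable setT (EFin \o (fun z => borel_id z ^+ 2)).
Proof. exact: normal_sqr_integrable. Qed.

End identity_variable.

Section independence.
Context d (T : measurableType d) (R : realType) (P : probability T R).

Lemma mutually_independent_comp (X Y : nat -> {RV P >-> R}) (f : R -> R) :
  measurable_fun setT f -> (forall k t, Y k t = f (X k t)) ->
  mutually_independent X -> mutually_independent Y.
Proof.
move=> mf YX X_indep J B mB.
have YE i : Y i @^-1` B i = X i @^-1` (f @^-1` B i).
  by apply/seteqP; split => t /=; rewrite YX.
rewrite (eq_bigcapr (fun i _ => YE i)) X_indep.
  by apply: eq_bigr => i _; rewrite YE.
by move=> i iJ; rewrite -[X in measurable X]setTI; apply: mf => //; exact: mB.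
Qed.

End independence.

Section clt.
Context (R : realType) (d : measure_display) (T : measurableType d)
  (P : probability T R) d0 (T0 : measurableType d0) (Q : probability T0 R).
Variables (U : {RV Q >-> R}) (mu : R) (p sigma : nat -> R)
  (X : nat -> {RV P >-> R}).
Hypothesis p_bounds : forall k, 0 <= p k <= 1.
Hypothesis sigma_ge1 : forall k, 1 <= sigma k.
Hypothesis X_indep : mutually_independent X.
Hypothesis X_cdf : forall k x, (cdf (X k) x =
  (1 - p k)%:E * cdf U (x - mu) + (p k)%:E * cdf U ((x - mu) / sigma k))%E.
Hypothesis iU2 : Q.-integrable setT (EFin \o (fun u => U u ^+ 2)).
Hypothesis EU : \int[Q]_u U u = 0.
Hypothesis EU2 : \int[Q]_u U u ^+ 2 = 1.
Local Notation gamma := (normal_prob (0 : R) 1).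

Local Notation tau2 k := ((1 - p k) + p k * sigma k ^+ 2).

Lemma mixture_variance_bounds k : 1 <= tau2 k <= sigma k ^+ 2.
Proof.
have s1 : 1 <= sigma k ^+ 2 by rewrite exprn_ege1.
by have /andP[p0 p1] := p_bounds k; apply/andP; split; nra.
Qed.

Lemma total_sd_sqr n : total_sd p sigma n ^+ 2 = \sum_(k < n) tau2 k.
Proof.
rewrite sqr_sqrtr//; apply: sumr_ge0 => k _.
by have /andP[+ _] := mixture_variance_bounds k; exact: le_trans.
Qed.

Lemma total_sd_gt0 n : (0 < n)%N -> 0 < total_sd p sigma n.
Proof.
case: n => // n _; rewrite sqrtr_gt0 big_ord_recr/= ltr_wpDl//.
  apply: sumr_ge0 => k _.
  by have /andP[+ _] := mixture_variance_bounds k; exact: le_trans.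
by have /andP[+ _] := mixture_variance_bounds n; exact: lt_le_trans.
Qed.

Definition standardized_term n k : {RV P >-> R} :=
  (total_sd p sigma n)^-1 \o* ((X k : {mfun T >-> R}) \- cst mu).

Lemma standardized_meanE n t : (0 < n)%N ->
  standardized_mean X mu p sigma n t = partial_sum (standardized_term n) n t.
Proof.
move=> n0; rewrite partial_sumE /standardized_mean /sample_mean /=.
rewrite mfun_sum -mulr_suml sumrB sumr_const card_ord.
have n1 : n%:R != 0 :> R by rewrite pnatr_eq0 -lt0n.
have s1 := total_sd_gt0 n0.
by rewrite -mulr_natr; field; rewrite n1 gt_eqF.
Qed.

(** The largest scale, relative to the standard deviation of the sum, of the
    first [n] terms. *)
Definition max_ratio n :=
  Num.sqrt (1 / total_sd p sigma n ^+ 2 *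
    \big[Num.max/0]_(k < n) (sigma k ^+ 2)).

Lemma max_ratio_ge n k : (k < n)%N ->
  sigma k / total_sd p sigma n <= max_ratio n.
Proof.
move=> kn; have n0 : (0 < n)%N by exact: leq_ltn_trans kn.
have s0 := total_sd_gt0 n0.
have r0 : 0 <= sigma k / total_sd p sigma n.
  by rewrite divr_ge0 ?(ltW s0)// (le_trans _ (sigma_ge1 k)).
rewrite -(ger0_norm r0) -sqrtr_sqr /max_ratio ler_wsqrtr//.
rewrite exprMn exprVn mulrC div1r ler_wpM2l ?invr_ge0 ?sqr_ge0//.
exact: (le_bigmax _ (fun k : 'I_n => sigma k ^+ 2) (Ordinal kn)).
Qed.

(** The variances of the standardized terms add up to 1, so that the bound on
    the remainders is a weighted mean. *)
Lemma lindeberg_bound n C g g1 g2 : (0 < n)%N -> taylor_bounded C g g1 g2 ->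
  `|\int[P]_t g (standardized_mean X mu p sigma n t) - \int[gamma]_z g z| <=
  4 * C * (tail_moment Q U (max_ratio n) +
           tail_moment gamma borel_id (max_ratio n)).
Proof.
move=> n0 tg; set s := total_sd p sigma n; have s0 : 0 < s := total_sd_gt0 n0.
have C0 := taylor_bounded_ge0 tg.
pose v k := tau2 k / s ^+ 2.
have v0 k : 0 < v k.
  rewrite divr_gt0 ?exprn_gt0//.
  by have /andP[+ _] := mixture_variance_bounds k; exact: lt_le_trans.
have sumv : \sum_(k < n) v k = 1.
  by rewrite -mulr_suml -total_sd_sqr divff// gt_eqF// exprn_gt0.
have Y_indep : mutually_independent (standardized_term n).
  apply: (mutually_independent_comp (f := fun x => (x - mu) / s) _ _ X_indep)
    => //.
  by apply: measurable_funM => //; exact: measurable_funB.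
have Y_var k := standardized_variance s (p_bounds k) (sigma_ge1 k) (X_cdf k)
  iU2 EU EU2.
have Y_mean k := standardized_mean0 s (p_bounds k) (sigma_ge1 k) (X_cdf k)
  iU2 EU EU2.
have := lindeberg_replacement Y_indep (fun k => (Y_var k).1) Y_mean
  (fun k => (Y_var k).2) v0 n tg.
rewrite -[\sum_(k < n) _]/(\sum_(k < n) v k) sumv sqrtr1.
under [X in `|_ - X| <= _ -> _]eq_Rintegral do rewrite mul1r.
under eq_Rintegral do rewrite -standardized_meanE//.
move=> /le_trans; apply; rewrite ler_wpM2l ?mulr_ge0//.
set L := _ + _; have -> : L = \sum_(k < n) v k * L.
  by rewrite -mulr_suml sumv mul1r.
apply: ler_sum => k _.
rewrite mulrDr; apply: lerD.
  exact: (standardized_lindeberg (p_bounds k) (sigma_ge1 k) s0 (X_cdf k) iU2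
    (max_ratio_ge (ltn_ord k))).
have cZ : 0 <= Num.sqrt (tau2 k / s ^+ 2) <= max_ratio n.
  rewrite sqrtr_ge0/=; apply: le_trans (max_ratio_ge (ltn_ord k)).
  have r0 : 0 <= sigma k / s.
    by rewrite divr_ge0 ?(ltW s0)// (le_trans _ (sigma_ge1 k)).
  rewrite -(ger0_norm r0) -sqrtr_sqr ler_wsqrtr// exprMn exprVn.
  rewrite ler_wpM2r ?invr_ge0 ?sqr_ge0//.
  by have /andP[] := mixture_variance_bounds k.
apply: le_trans (lindeberg_scale_le measurable_borel_id
  borel_id_normal_sqr_integrable cZ) _.
by have v0k : 0 <= tau2 k / s ^+ 2 := ltW (v0 k); rewrite sqr_sqrtr.
Qed.

Lemma cvg_test_function g : test_function g ->
  1 / total_sd p sigma n ^+ 2 * \big[Num.max/0]_(k < n) (sigma k ^+ 2)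
    @[n --> \oo] --> (0 : R) ->
  \int[P]_t g (standardized_mean X mu p sigma n t) @[n --> \oo] -->
  \int[gamma]_z g z.
Proof.
move=> [C [g1 [g2 tg]]] negl.
have mU : measurable_fun setT U by exact: measurable_funPT.
have r_cvg : max_ratio n @[n --> \oo] --> (0 : R).
  rewrite -[X in _ --> X](sqrtr0 R).
  by apply: continuous_cvg => //; exact: sqrt_continuous.
have r0 n : 0 <= max_ratio n by exact: sqrtr_ge0.
have b_cvg : 4 * C * (tail_moment Q U (max_ratio n) +
    tail_moment gamma borel_id (max_ratio n)) @[n --> \oo] -->
    (4 * C * (0 + 0) : R).
  apply: cvgMl_tmp; apply: cvgD; first exact: cvg_tail_moment.
  exact: (cvg_tail_moment measurable_borel_id borel_id_normal_sqr_integrable).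
rewrite addr0 mulr0 in b_cvg.
apply/cvgrPdist_le => /= e e0; near=> n.
rewrite distrC; apply: le_trans (lindeberg_bound _ tg) _.
  by near: n; exact: nbhs_infty_gt.
rewrite (le_trans (ler_norm _))// -[X in `|X|]subr0 distrC.
by near: n; move: b_cvg => /cvgrPdist_le; exact.
Unshelve. all: by end_near. Qed.

End clt.

Section normal_law.
Context (R : realType) (d : measure_display) (T : measurableType d)
  (P : probability T R) (xi : {RV P >-> R}).

Lemma normal_law_Rintegral g : has_law xi (normal_prob 0 1) ->
  test_function g ->
  \int[P]_t g (xi t) = \int[normal_prob (0 : R) 1]_z g z.
Proof.
move=> law tg; congr fine.
have mg : measurable_fun setT (EFin \o g).
  by apply/measurable_EFinP; exact: test_function_measurable.
have itest d0 (T0 : measurableType d0) (Q : probability T0 R)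
    (Z : {RV Q >-> R}) :
    Q.-integrable setT (EFin \o (g \o Z)).
  by apply: test_function_integrable => //; exact: measurable_funPT.
rewrite -[LHS](integral_distribution (X := xi) mg (itest _ _ _ xi)).
pose Z : {RV (normal_prob (0 : R) 1) >-> R} := borel_id.
rewrite -[RHS](integral_distribution (X := Z) mg (itest _ _ _ Z)).
by apply: eq_measure_integral => A mA _; exact: law.
Qed.

End normal_law.

Theorem theorem4p4 (R : realType) (d : measure_display) (T : measurableType d)
    (P : probability T R) (d' : measure_display) (T' : measurableType d')
    (P' : probability T' R)
    (F : cumulativeBounded (0 : R) (1 : R)) (mu : R) (p sigma : nat -> R)
    (X : nat -> {RV P >-> R}) (xi : {RV P' >-> R})
    (F_mean : (\int[lebesgue_stieltjes_measure F]_x x%:E = 0)%E)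
    (F_var : (\int[lebesgue_stieltjes_measure F]_x (x ^+ 2)%:E = 1)%E)
    (p_bounds : forall k, 0 <= p k <= 1)
    (sigma_ge1 : forall k, 1 <= sigma k)
    (X_indep : mutually_independent X)
    (X_cdf : forall k x,
      cdf (X k) x =
      ((1 - p k) * F (x - mu) + p k * F ((x - mu) / sigma k))%:E)
    (xi_normal : has_law xi (normal_prob 0 1))
    (sigma_negligible :
      1 / total_sd p sigma n ^+ 2 * \big[Num.max/0]_(k < n) (sigma k ^+ 2)
        @[n --> \oo] --> (0 : R)) :
  converges_weakly (standardized_mean X mu p sigma) xi.
Proof.
pose U : {RV (lebesgue_stieltjes_measure F) >-> R} := borel_id.
have U_cdf x : cdf U x = (F x)%:E by exact: cdf_lebesgue_stieltjes_id.
have iU2 : (lebesgue_stieltjes_measure F).-integrable setT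
    (EFin \o (fun u => U u ^+ 2)).
  apply/integrableP; split.
    by apply/measurable_EFinP; exact: measurable_funX.
  under eq_integral do rewrite /= ger0_norm ?sqr_ge0//.
  by rewrite F_var ltry.
have EU : \int[lebesgue_stieltjes_measure F]_u U u = 0.
  by rewrite /Rintegral F_mean.
have EU2 : \int[lebesgue_stieltjes_measure F]_u U u ^+ 2 = 1.
  by rewrite /Rintegral F_var.
apply: converges_weakly_test => g tg.
rewrite (normal_law_Rintegral xi_normal tg).
apply: (cvg_test_function p_bounds sigma_ge1 X_indep _ iU2 EU EU2 tg) => //.
by move=> k x; rewrite X_cdf !U_cdf -!EFinM -EFinD.
Qed.
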